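(* Let $(\Omega, \mathcal{F}, \mu)$ be a probability space which is either non-atomic, or completely atomic with all atoms having equal measure, and let $X$ be a rearrangement invariant Banach function space (with the Fatou property) over $(\Omega,\mathcal F,\mu)$. For an integrable function $u$ write $u_\Omega := \int_\Omega u \, d\mu$. (i) If $f, g \in X$ are real-valued and bounded, then $$ \|fg - (fg)_\Omega\|_X \leq \|f\|_\infty \|g - g_\Omega\|_X + \|g\|_\infty \|f - f_\Omega\|_X. $$ (ii) If $f$ belongs to $X$ and $g$ belongs to the associate space $X'$, then $$ \|fg - (fg)_\Omega\|_1 \leq \|f\|_X \|g - g_\Omega\|_{X'} + \|g\|_{X'} \|f - f_\Omega\|_X. $$
   Context: Let $\mathcal{L}_0$ denote the algebra of $\mu$-measurable real-valued functions on $\Omega$ (functions equal $\mu$-a.e. are identified). A linear space $X \subseteq \mathcal{L}_0$ is a Banach function space if it is endowed with a (complete) norm $\|\cdot\|_X$ satisfying the ideal property: if $f \in \mathcal{L}_0$, $g \in X$ and $|f| \leq |g|$ $\mu$-a.e., then $f \in X$ and $\|f\|_X \leq \|g\|_X$. All Banach function spaces are assumed to have the Fatou property: if $f_n \in X$, $0 \leq f_n \uparrow f$ $\mu$-a.e. and the increasing sequence $(f_n)$ is norm bounded, then $f \in X$ and $\|f_n\|_X \to \|f\|_X$. Two functions $f, g \in \mathcal{L}_0$ are equimeasurable if $|f|$ and $|g|$ have the same distribution function. $X$ is rearrangement invariant if whenever $f \in X$, $g \in \mathcal{L}_0$, and $f$ and $g$ are equimeasurable, then $g \in X$ and $\|f\|_X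 = \|g\|_X$. The associate space (Köthe dual) $X'$ is the collection of $f \in \mathcal{L}_0$ for which $\|f\|_{X'} = \sup\{ \int_\Omega f h \, d\mu : h \in X,\ \|h\|_X \leq 1 \}$ is finite (by the ideal property one may equivalently use $\int_\Omega |fh| \, d\mu$). $\|\cdot\|_1$ and $\|\cdot\|_\infty$ denote the usual norms of $L^1(\Omega,\mu)$ and $L^\infty(\Omega,\mu)$. *)

(* Defs.v *)
From HB Require Import structures.
From mathcomp Require Import all_boot all_order all_algebra.
From mathcomp Require Import all_classical all_reals all_analysis.
From mathcomp Require Import measurable_realfun.

Set Implicit Arguments.
Unset Strict Implicit.
Unset Printing Implicit Defensive.

Import Order.TTheory GRing.Theory Num.Theory.
Import numFieldNormedType.Exports.

Local Open Scope classical_set_scope.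
Local Open Scope ring_scope.

Definition atom d (T : measurableType d) (R : realType)
    (mu : {measure set T -> \bar R}) (A : set T) : Prop :=
  [/\ measurable A, (0 < mu A)%E &
      forall B, measurable B -> B `<=` A -> mu B = 0%E \/ mu (A `\` B) = 0%E].

Definition nonatomic d (T : measurableType d) (R : realType)
    (mu : {measure set T -> \bar R}) : Prop :=
  forall A, ~ atom mu A.

Definition completely_atomic d (T : measurableType d) (R : realType)
    (mu : {measure set T -> \bar R}) : Prop :=
  forall A, measurable A -> (0 < mu A)%E -> exists2 B, atom mu B & B `<=` A.

Definition atoms_equal_measure d (T : measurableType d) (R : realType)
    (mu : {measure set T -> \bar R}) : Prop :=
  forall A B, atom mu A -> atom mu B -> mu A = mu B.

(* The space L_0 is represented by measurable functions rather than by their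
   classes modulo a.e. equality: the norm separates functions up to a.e.
   equality, and by [bfs_ideal] both the carrier and the norm are invariant
   under a.e. equality. The values of [bfs_norm] outside the carrier are
   arbitrary. *)
Record banach_function_space d (T : measurableType d) (R : realType)
    (mu : {measure set T -> \bar R}) := BanachFunctionSpace {
  bfs_carrier : set {mfun T >-> R} ;
  bfs_norm : {mfun T >-> R} -> R ;
  bfs_0 : bfs_carrier 0 ;
  bfs_D : forall f g, bfs_carrier f -> bfs_carrier g -> bfs_carrier (f + g) ;
  bfs_Z : forall (a : R) f, bfs_carrier f -> bfs_carrier (a *: f) ;
  bfs_norm_ge0 : forall f, bfs_carrier f -> 0 <= bfs_norm f ;
  bfs_norm_eq0 : forall f, bfs_carrier f ->
    (bfs_norm f = 0 <-> \forall x \ae mu, f x = 0) ;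
  bfs_normZ : forall (a : R) f, bfs_carrier f ->
    bfs_norm (a *: f) = `|a| * bfs_norm f ;
  bfs_normD : forall f g, bfs_carrier f -> bfs_carrier g ->
    bfs_norm (f + g) <= bfs_norm f + bfs_norm g ;
  bfs_complete : forall u : nat -> {mfun T >-> R},
    (forall n, bfs_carrier (u n)) ->
    (forall e : R, 0 < e -> exists N : nat, forall m n : nat,
       (N <= m)%N -> (N <= n)%N -> bfs_norm (u m - u n) < e) ->
    exists2 l, bfs_carrier l & bfs_norm (u n - l) @[n --> \oo] --> (0 : R) ;
  bfs_ideal : forall f g : {mfun T >-> R}, bfs_carrier g ->
    (\forall x \ae mu, `|f x| <= `|g x|) ->
    bfs_carrier f /\ bfs_norm f <= bfs_norm g ;
  bfs_fatou : forall (u : nat -> {mfun T >-> R}) (f : {mfun T >-> R}),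
    (forall n, bfs_carrier (u n)) ->
    (\forall x \ae mu, [/\ forall n, 0 <= u n x,
       forall n, u n x <= u n.+1 x & u n x @[n --> \oo] --> f x]) ->
    (exists M : R, forall n, bfs_norm (u n) <= M) ->
    bfs_carrier f /\ bfs_norm (u n) @[n --> \oo] --> bfs_norm f }.

Definition equimeasurable d (T : measurableType d) (R : realType)
    (mu : {measure set T -> \bar R}) (f g : T -> R) : Prop :=
  forall t : R, mu [set x | t < `|f x|] = mu [set x | t < `|g x|].

Definition rearrangement_invariant d (T : measurableType d) (R : realType)
    (mu : {measure set T -> \bar R}) (X : banach_function_space mu) : Prop :=
  forall f g : {mfun T >-> R}, bfs_carrier X f -> equimeasurable mu f g ->
    bfs_carrier X g /\ bfs_norm X f = bfs_norm X g.

(* Whenever [f * h] has no integral, the library assigns it the value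
   [+oo - +oo = -oo]; such [h] are thus ignored. This does not change the
   supremum: replacing [h] by [|h| sgn f] shows that it is [+oo] in that case. *)
Definition associate_norm d (T : measurableType d) (R : realType)
    (mu : {measure set T -> \bar R}) (X : banach_function_space mu)
    (f : {mfun T >-> R}) : \bar R :=
  ereal_sup [set (\int[mu]_x (f x * h x)%:E)%E
            | h in [set h : {mfun T >-> R} | bfs_carrier X h /\ bfs_norm X h <= 1]].

Definition associate_space d (T : measurableType d) (R : realType)
    (mu : {measure set T -> \bar R}) (X : banach_function_space mu) :
    set {mfun T >-> R} :=
  [set f | (associate_norm X f < +oo)%E].

Definition mean_centered d (T : measurableType d) (R : realType)
    (mu : {measure set T -> \bar R}) (u : {mfun T >-> R}) : {mfun T >-> R} :=
  u - cst (\int[mu]_x u x).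

(* Main.v *)
Require Import Defs.
From HB Require Import structures.
From mathcomp Require Import all_boot all_order all_algebra.
From mathcomp Require Import all_classical all_reals all_analysis.
From mathcomp Require Import measurable_realfun ess_sup_inf.
From mathcomp Require Import ring lra.

Import Order.TTheory GRing.Theory Num.Theory.
Import numFieldNormedType.Exports.

Local Open Scope classical_set_scope.
Local Open Scope ring_scope.

Set Implicit Arguments.
Unset Strict Implicit.
Unset Printing Implicit Defensive.

(** For a sign [s = 1] or [s = -1] consider
      W_s(phi, u)(x) = 1/2 * integral over y of
                         (phi x + s phi y) u x + (phi x - s phi y) u y,
    written out in [leibniz_op]. The key fact, [bfs_ball_leibniz_op], is that
    u |-> W_s(phi, u) is a contraction of every rearrangement invariant space
    as soon as |phi| <= 1.

    (i) Averaging in y the symmetric form of the product rule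
      f x g x - f y g y = 1/2 (f x + f y) (g x - g y) + 1/2 (g x + g y) (f x - f y)
    shows that fg minus its mean is W_1(f, g - mean g) + W_1(g, f - mean f)
    ([mean_centered_mul]); the triangle inequality and the contraction property
    for f / ||f||_oo and g / ||g||_oo conclude.

    (ii) The L^1 norm of F = fg - mean(fg) is the integral of phi F with phi
    the sign of F. As W_{-1}(phi, .) is the transpose of what (i) produces,
    this integral is that of (g - mean g) W_{-1}(phi, f) + g W_{-1}(phi, f - mean f)
    ([Rintegral_mul_mean_centered_mul]), and it is bounded by the duality between
    X and its associate space and by the contraction property.

    The contraction property is combinatorial. On functions that are constant
    on the pieces of a partition into n pieces of equal probability, labelled
    by Z/n, the average over y is the average over the n reflections
    x |-> k - x. Because a reflection pi is an involution, when phi only takes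
    the values 1 and -1 the k-th term is, up to signs, u permuted by the map
    which applies pi on a pi-invariant set of labels; so it is equimeasurable
    with u. Every phi with |phi| <= 1 is a convex combination of sign functions
    ([symmetric_convex_average]). The Fatou property makes the balls of X closed
    under a.e. convergence ([bfs_ball_fatou]), so it remains to approximate phi
    and u by such step functions, keeping the bound 1 on phi and without
    increasing |u| ([step_approximable]). On a
    non-atomic space this follows from the existence of subsets of any
    prescribed probability ([nonatomic_subset_of_prob]); on an atomic space with
    equal atoms there are finitely many of them and measurable functions are
    a.e. constant on each.

    Passing to the limit in W_s requires u to be integrable. For the bounded
    truncations of u this is clear, and W_{-1}(1, u) is the mean of u; so the
    contraction property bounds their means by a multiple of the norm of u,
    whence the inclusion of X in L^1 ([bfs_integrable]). *)

(** * Averages over reflections in symmetric convex sets *)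

Section SymmetricConvex.
Context {R : realType} {n : nat}.
Variable B : ('I_n.+1 -> R) -> Prop.
Hypothesis B_convex : forall (t : R) a b, 0 <= t <= 1 -> B a -> B b ->
  B (fun i => t * a i + (1 - t) * b i).
Hypothesis B_symmetric : forall a b (sigma : 'I_n.+1 -> 'I_n.+1),
  injective sigma -> (forall i, `|b i| = `|a (sigma i)|) -> B a -> B b.

Lemma symmetric_convex_ext a b : a =1 b -> B a -> B b.
Proof. by move=> ab; apply: (B_symmetric (sigma := id)) => // i; rewrite ab. Qed.

(** For b with values 1 and -1, one of the two coefficients vanishes at each i
    and the other is a sign: the value is b i * a i where b i = s * b (pi i)
    and b i * a (pi i) elsewhere. Since pi is an involution and s is a sign,
    this dichotomy is pi-invariant, so a is only permuted and multiplied by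
    signs. *)
Lemma symmetric_convex_sign_reflection (s : R) (pi : 'I_n.+1 -> 'I_n.+1)
    (a b : 'I_n.+1 -> R) :
  s = 1 \/ s = -1 -> involutive pi -> (forall i, `|b i| = 1) -> B a ->
  B (fun i => 2^-1 * ((b i + s * b (pi i)) * a i
                      + (b i - s * b (pi i)) * a (pi i))).
Proof.
move=> hs piK b1.
have b_pm i : b i = 1 \/ b i = -1.
  by have /eqP := b1 i; rewrite eqr_norml => /andP[/orP[]/eqP-> _]; [left|right].
pose sigma i := if b i == s * b (pi i) then i else pi i.
have sigmaK : involutive sigma.
  move=> i; rewrite /sigma.
  have e : (b (pi i) == s * b i) = (b i == s * b (pi i)).
    by rewrite eq_sym; case: hs => ->; rewrite ?mul1r// !mulN1r eqr_oppLR.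
  have [h|h] := boolP (b i == s * b (pi i)); first by rewrite h.
  by rewrite piK e (negbTE h).
apply: (B_symmetric (inv_inj sigmaK)) => i.
rewrite /sigma; have b1i := b1 i; case: eqP => [<-|h].
  rewrite subrr mul0r addr0 -mulr2n -(mulr_natl (b i)) !mulrA.
  by rewrite mulVf ?pnatr_eq0// mul1r normrM b1i mul1r.
have -> : s * b (pi i) = - b i.
  by move: h; case: hs => ->; case: (b_pm i) => ->; case: (b_pm (pi i)) => -> //;
    rewrite ?mul1r ?mulN1r ?opprK.
rewrite subrr mul0r add0r opprK -mulr2n -(mulr_natl (b i)) !mulrA.
by rewrite mulVf ?pnatr_eq0// mul1r normrM b1i mul1r.
Qed.

(** The expression is affine in each b i, hence lies on the segment joining the
    values at b i = 1 and b i = -1. The induction moves the coordinates one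
    at a time to the extreme points. *)
Lemma symmetric_convex_reflection (s : R) (pi : 'I_n.+1 -> 'I_n.+1)
    (a b : 'I_n.+1 -> R) :
  s = 1 \/ s = -1 -> involutive pi -> (forall i, `|b i| <= 1) -> B a ->
  B (fun i => 2^-1 * ((b i + s * b (pi i)) * a i
                      + (b i - s * b (pi i)) * a (pi i))).
Proof.
move=> hs piK + Ba.
have [m] := ubnP #|[pred i | `|b i| != 1]|.
elim: m b => // m IH b; rewrite ltnS => bm b1.
have [/forallP b_sign|/forallPn[j bj]] := boolP [forall i, `|b i| == 1].
  by apply: symmetric_convex_sign_reflection => // i; apply/eqP.
pose bs (e : R) i := if i == j then e else b i.
have lt_bs e : `|e| = 1 -> (#|[pred i | (`|bs e i| != 1)%R]| < m)%N.
  move=> e1; apply: leq_trans bm; apply: proper_card; apply/properP; split.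
    apply/fintype.subsetP => i; rewrite !inE /bs.
    by case: (i =P j) => // _; rewrite e1 eqxx.
  by exists j; rewrite !inE /bs ?eqxx ?e1 ?eqxx.
have le_bs e i : `|e| = 1 -> `|bs e i| <= 1.
  by move=> e1; rewrite /bs; case: ifP => // _; rewrite e1.
have n1 : `|1 : R| = 1 by rewrite normr1.
have nm1 : `|-1 : R| = 1 by rewrite normrN1.
(* [b j = t * 1 + (1 - t) * (-1)] *)
pose t := 2^-1 * (1 + b j).
have t01 : 0 <= t <= 1.
  by have := b1 j; rewrite ler_norml /t => /andP[? ?]; apply/andP; split; lra.
have bE i : b i = t * bs 1 i + (1 - t) * bs (-1) i.
  by rewrite /bs; case: eqP => [->|_]; rewrite /t; lra.
have := B_convex t01 (IH _ (lt_bs _ n1) (fun i => le_bs _ i n1))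
  (IH _ (lt_bs _ nm1) (fun i => le_bs _ i nm1)).
apply: symmetric_convex_ext => i; rewrite (bE i) (bE (pi i)); ring.
Qed.

Lemma symmetric_convex_mean m (v : nat -> 'I_n.+1 -> R) :
  (forall k, (k <= m)%N -> B (v k)) ->
  B (fun i => m.+1%:R^-1 * \sum_(k < m.+1) v k i).
Proof.
elim: m => [|m IH] vB.
  apply: (symmetric_convex_ext _ (vB 0%N isT)) => i.
  by rewrite big_ord_recl big_ord0 addr0 invr1 mul1r.
(* the weight of the first m + 1 terms in the mean of m + 2 terms *)
pose t : R := m.+1%:R / m.+2%:R.
have m2 : m.+2%:R != 0 :> R by rewrite pnatr_eq0.
have m1 : m.+1%:R != 0 :> R by rewrite pnatr_eq0.
have t01 : 0 <= t <= 1.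
  by rewrite divr_ge0//= ler_pdivrMr ?ltr0n// mul1r ler_nat.
have t1 : 1 - t = m.+2%:R^-1.
  by apply: (mulIf m2); rewrite mulrBl mulVf// /t divfK// mul1r -natrB// subSnn.
have := B_convex t01 (IH (fun k km => vB k (leqW km))) (vB _ (leqnn _)).
apply: symmetric_convex_ext => i; rewrite t1 [in RHS]big_ord_recr/= mulrDr.
by congr (_ + _); rewrite mulrA; congr (_ * _); rewrite /t mulrAC mulfV// mul1r.
Qed.

(** In Z/(n+1) the reflections i |-> k - i are involutions, and for fixed i
    they reach each j exactly once as k varies; so the average over j is an
    average over reflections. *)
Lemma symmetric_convex_average (s : R) (a b : 'I_n.+1 -> R) :
  s = 1 \/ s = -1 -> (forall i, `|b i| <= 1) -> B a ->
  B (fun i => n.+1%:R^-1 * \sum_(j < n.+1)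
       2^-1 * ((b i + s * b j) * a i + (b i - s * b j) * a j)).
Proof.
move=> hs b1 Ba.
(* subtraction of the cyclic group structure of the ordinals *)
pose refl (k i : 'I_n.+1) := (k - i)%R.
pose v k i := 2^-1 * ((b i + s * b (refl (inord k) i)) * a i
                     + (b i - s * b (refl (inord k) i)) * a (refl (inord k) i)).
have vB k : B (v k).
  apply: symmetric_convex_reflection => // i.
  by rewrite /refl opprB addrC subrK.
apply: symmetric_convex_ext (symmetric_convex_mean (m := n) (fun k _ => vB k)) => i.
congr (_ * _); rewrite [RHS](reindex_onto (refl ^~ i) (fun j => j + i))/=; last first.
  by move=> j _; rewrite /refl addrK.
rewrite [RHS](eq_bigl xpredT) => [|k]; last by rewrite /refl/= subrK eqxx.
by apply: eq_bigr => k _; rewrite /v inord_val.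
Qed.

End SymmetricConvex.

(** * Balls of a Banach function space and step functions *)

Lemma mfunZE d (T : measurableType d) (R : realType) (a : R)
  (f : {mfun T >-> R}) x : (a *: f) x = a * f x.
Proof. by []. Qed.

Section Ball.
Context d (T : measurableType d) (R : realType) (P : probability T R).
Variable X : banach_function_space P.

Definition bfs_ball (M : R) (f : {mfun T >-> R}) :=
  bfs_carrier X f /\ bfs_norm X f <= M.

Lemma bfs_ball_ideal M (f g : {mfun T >-> R}) :
  bfs_ball M g -> (\forall x \ae P, `|f x| <= `|g x|) -> bfs_ball M f.
Proof.
by move=> [Xg gM] /(bfs_ideal Xg)[Xf fg]; split => //; exact: le_trans gM.
Qed.

Lemma bfs_ball_ae M (f g : {mfun T >-> R}) :
  (\forall x \ae P, g x = f x) -> bfs_ball M g -> bfs_ball M f.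
Proof.
by move=> fg /bfs_ball_ideal; apply; apply: filterS fg => x ->.
Qed.

Lemma bfs_ball_convex M (t : R) (f g : {mfun T >-> R}) : 0 <= t <= 1 ->
  bfs_ball M f -> bfs_ball M g -> bfs_ball M (t *: f + (1 - t) *: g).
Proof.
move=> /andP[t0 t1] [Xf fM] [Xg gM]; split.
  by apply: bfs_D; exact: bfs_Z.
have t1' : 0 <= 1 - t by rewrite subr_ge0.
apply: le_trans (bfs_normD (bfs_Z _ Xf) (bfs_Z _ Xg)) _.
rewrite !bfs_normZ// !ger0_norm//.
apply: le_trans (lerD (ler_wpM2l t0 fM) (ler_wpM2l t1' gM)) _.
by rewrite -mulrDl addrC subrK mul1r.
Qed.

(** The monotone Fatou property applied to the infima over k >= n of the
    |v k|, which increase to |f| and are dominated by the |v n|. *)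
Lemma bfs_ball_fatou M (v : nat -> {mfun T >-> R}) (f : {mfun T >-> R}) :
  (forall n, bfs_ball M (v n)) ->
  (\forall x \ae P, v n x @[n --> \oo] --> f x) -> bfs_ball M f.
Proof.
move=> vM vf.
pose w n x := infs (fun k => `|v k x|) n.
have lb x : has_lbound (range (fun k => `|v k x|)).
  by exists 0 => _ [k _ <-].
have mw n : measurable_fun setT (w n).
  apply: (measurable_fun_infs (h := fun k x => `|v k x|)) => [x _|k]; first exact: lb.
  exact: measurableT_comp.
pose W n : {mfun T >-> R} := mfun_Sub (mem_set (mw n)).
have W_le n x : `|W n x| <= `|v n x|.
  rewrite ger0_norm; last first.
    apply: lb_le_inf => [|_ [k _ <-]//].
    by exists `|v n x|, n => /=.
  by apply: ge_inf; [exact: has_lbound_sdrop|exists n => /=].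
have WM n : bfs_ball M (W n).
  by apply: bfs_ball_ideal (vM n) _; apply: nearW => x; exact: W_le.
have mF : measurable_fun setT (fun x => `|f x|) by exact: measurableT_comp.
pose F : {mfun T >-> R} := mfun_Sub (mem_set mF).
have [XF cvgF] : bfs_carrier X F /\ bfs_norm X (W n) @[n --> \oo] --> bfs_norm X F.
  apply: bfs_fatou => [n||]; first by have [] := WM n.
    apply: filterS vf => x vfx; split => [n|n|].
    - by apply: lb_le_inf => [|_ [k _ <-]//]; exists `|v n x|, n => /=.
    - exact: (nondecreasing_infs (lb x) (leqnSn n)).
    - by apply: cvg_infs; exact: cvg_norm.
  by exists M => n; have [] := WM n.
have FM : bfs_ball M F.
  split => //; rewrite -(cvg_lim _ cvgF)//; apply: limr_le.
    by apply/cvg_ex; exists (bfs_norm X F).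
  by apply: nearW => n; have [] := WM n.
by apply: bfs_ball_ideal FM _; apply: nearW => x /=; rewrite normr_id.
Qed.

End Ball.

Section Step.
Context d (T : measurableType d) (R : realType) (P : probability T R).

Record equal_labelling n := EqualLabelling {
  label :> T -> 'I_n.+1 ;
  label_measurable : forall i, measurable (label @^-1` [set i]) ;
  label_prob : forall i, P (label @^-1` [set i]) = (n.+1%:R^-1)%:E }.

Context {n : nat}.
Variable L : equal_labelling n.

Definition step_fun (a : 'I_n.+1 -> R) : {mfun T >-> R} :=
  \sum_i a i *: indic_mfun (L @^-1` [set i]) (label_measurable L i).

Lemma step_funE a x : step_fun a x = a (L x).
Proof.
have termE i : (a i *: indic_mfun _ (label_measurable L i)) x =
    a i * (x \in L @^-1` [set i])%:R by rewrite -indicE.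
rewrite mfun_sum; under eq_bigr do rewrite termE.
rewrite (bigD1 (L x))//= big1 => [|i iL].
  by rewrite addr0 mem_set// mulr1.
by rewrite memNset ?mulr0// => Li; rewrite -Li eqxx in iL.
Qed.

Lemma Rintegral_step_fun a : \int[P]_x step_fun a x = n.+1%:R^-1 * \sum_i a i.
Proof.
have mL i := label_measurable L i.
have PL i : (P : {measure set T -> \bar R}) (L @^-1` [set i]) = (n.+1%:R^-1)%:E.
  exact: label_prob.
have intL i : P.-integrable setT (fun x => (\1_(L @^-1` [set i]) x)%:E : \bar R).
  apply/integrableP; split.
    by apply/measurable_EFinP; exact: measurable_indic.
  under eq_integral do rewrite /= ger0_norm//.
  by rewrite integral_indic// setIT PL ltry.
rewrite /Rintegral (_ : (\int[P]_x _ = \sum_i (a i)%:E * (n.+1%:R^-1)%:E)%E).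
  by rewrite sumEFin/= -mulr_suml mulrC.
transitivity (\int[P]_x (\sum_(i < n.+1) (a i)%:E * (\1_(L @^-1` [set i]) x)%:E))%E.
  apply: eq_integral => x _; rewrite mfun_sum -sumEFin.
  by apply: eq_bigr => i _; rewrite -EFinM.
rewrite integral_sum// => [|i]; last exact: integrableZl.
apply: eq_bigr => i _; rewrite integralZl// integral_indic// setIT.
by rewrite PL.
Qed.

(** The pieces having equal probability, the distribution of a step function
    is the counting measure on its values; a boolean predicate q covers the
    distribution function as well as events given by the labels. *)
Lemma prob_step_fun (q : R -> bool) a :
  P [set x | q (step_fun a x)] = (n.+1%:R^-1 * \sum_i (q (a i))%:R)%:E.
Proof.
have qE : [set x | q (step_fun a x)] = step_fun (fun i => (q (a i))%:R) @^-1` [set 1].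
  apply/seteqP; split => x /=; rewrite !step_funE; first by move->.
  by case: (q _) => // /eqP; rewrite eq_sym oner_eq0.
have mq : measurable [set x | q (step_fun a x)].
  by rewrite qE -[X in measurable X]setTI; exact: measurable_funP.
rewrite -Rintegral_step_fun -[LHS]fineK ?fin_num_measure//; congr EFin.
rewrite /Rintegral -[in LHS](setIT [set x | q _]) -integral_indic//.
congr fine; apply: eq_integral => x _; congr EFin.
rewrite step_funE indicE; congr (nat_of_bool _)%:R.
apply/idP/idP => [/set_mem/=|qx]; rewrite ?step_funE//.
by apply/mem_set; rewrite /= step_funE.
Qed.

Lemma equimeasurable_step_fun a b (sigma : 'I_n.+1 -> 'I_n.+1) :
  injective sigma -> (forall i, `|b i| = `|a (sigma i)|) ->
  equimeasurable P (step_fun a) (step_fun b).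
Proof.
move=> /injF_bij bij ba t.
have distr c := prob_step_fun (fun y => t < `|y|) c.
rewrite [LHS]distr [RHS]distr.
congr (_ * _)%:E; rewrite (reindex sigma)/=; last exact: onW_bij.
by apply: eq_bigr => i _; rewrite ba.
Qed.

End Step.

(** * The operator and its contraction property *)

Section LeibnizOp.
Context d (T : measurableType d) (R : realType) (P : probability T R).

(** The average over y is expanded into the means of phi, u and phi * u. *)
Definition leibniz_op (s : R) (phi u : {mfun T >-> R}) : {mfun T >-> R} :=
  2^-1 *: ((phi + cst (s * \int[P]_x phi x)) * u + (\int[P]_x u x) *: phi
           - cst (s * \int[P]_x (phi x * u x))).

Lemma leibniz_opE s phi u x : leibniz_op s phi u x =
  2^-1 * ((phi x + s * \int[P]_x phi x) * u x + (\int[P]_x u x) * phi x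
          - s * \int[P]_x (phi x * u x)).
Proof. by []. Qed.

Lemma Rintegral_dominated_cvg (f_ : nat -> {mfun T >-> R}) (f g : {mfun T >-> R}) :
  P.-integrable setT (EFin \o g) ->
  (\forall x \ae P, forall n, `|f_ n x| <= `|g x|) ->
  (\forall x \ae P, f_ n x @[n --> \oo] --> f x) ->
  \int[P]_x f_ n x @[n --> \oo] --> \int[P]_x f x.
Proof.
move=> ig fg ff.
have mf (h : {mfun T >-> R}) : measurable_fun setT (EFin \o h).
  by apply/measurable_EFinP.
have [|||||intf _ cvg] := @dominated_convergence _ _ _ P _ measurableT
    (fun n => EFin \o f_ n) (EFin \o f) (fun x => `|(EFin \o g) x|)%E.
- by move=> n; exact: mf.
- exact: mf.
- by apply: filterS ff => x ffx _; apply/cvg_EFin => //; exact: nearW.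
- exact: integrable_abse.
- by apply: filterS fg => x fgx n _ /=; rewrite lee_fin.
apply: fine_cvg; rewrite fineK//; exact: integrable_fin_num.
Qed.

Lemma cvg_leibniz_op (s : R) (phi_ u_ : nat -> {mfun T >-> R})
    (phi u : {mfun T >-> R}) :
  P.-integrable setT (EFin \o u) ->
  (forall n x, `|phi_ n x| <= 1) ->
  (\forall x \ae P, forall n, `|u_ n x| <= `|u x|) ->
  (\forall x \ae P, phi_ n x @[n --> \oo] --> phi x) ->
  (\forall x \ae P, u_ n x @[n --> \oo] --> u x) ->
  \forall x \ae P,
    leibniz_op s (phi_ n) (u_ n) x @[n --> \oo] --> leibniz_op s phi u x.
Proof.
move=> iu phi1 u_le cvgphi cvgu.
have i1 : P.-integrable setT (EFin \o (cst 1 : {mfun T >-> R})).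
  exact: finite_measure_integrable_cst.
have int_phi : \int[P]_x phi_ n x @[n --> \oo] --> \int[P]_x phi x.
  apply: (Rintegral_dominated_cvg i1) => //.
  by apply: nearW => x n; rewrite /= normr1.
have int_u := Rintegral_dominated_cvg iu u_le cvgu.
have int_phiu : \int[P]_x (phi_ n x * u_ n x) @[n --> \oo] --> \int[P]_x (phi x * u x).
  apply: (@Rintegral_dominated_cvg (fun n => phi_ n * u_ n) (phi * u) u iu).
    apply: filterS u_le => x ux n; rewrite /= normrM.
    by rewrite -[leRHS]mul1r ler_pM.
  by apply: filterS2 cvgphi cvgu => x phix ux; exact: cvgM.
apply: filterS2 cvgphi cvgu => x phix ux.
under eq_fun do rewrite leibniz_opE; rewrite leibniz_opE.
apply: cvgMr; apply: cvgB; last exact: cvgMr.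
apply: cvgD; apply: cvgM => //.
by apply: cvgD => //; exact: cvgMr.
Qed.

(** The bound of the approximants of u by |u| itself makes them members of X
    of no larger norm, by the ideal property, and provides the dominating
    function for the convergence of their means. *)
Definition step_approximable (phi u : {mfun T >-> R}) :=
  exists (m : nat -> nat) (L : forall k, equal_labelling P (m k))
    (b a : forall k, 'I_(m k).+1 -> R),
    (forall k i, `|b k i| <= 1) /\
    \forall x \ae P, [/\ forall k, `|step_fun (L k) (a k) x| <= `|u x|,
      step_fun (L k) (b k) x @[k --> \oo] --> phi x &
      step_fun (L k) (a k) x @[k --> \oo] --> u x].

Variable X : banach_function_space P.
Hypothesis hX : rearrangement_invariant X.

(** Rearrangement invariance makes the coefficient vectors of the step functions
    in a ball of X a symmetric convex set, and on coefficients the operator is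
    the average of [symmetric_convex_average]. *)
Lemma bfs_ball_leibniz_op_step M n (L : equal_labelling P n) (s : R)
    (b a : 'I_n.+1 -> R) : s = 1 \/ s = -1 -> (forall i, `|b i| <= 1) ->
  bfs_ball X M (step_fun L a) ->
  bfs_ball X M (leibniz_op s (step_fun L b) (step_fun L a)).
Proof.
move=> hs b1 Ba.
have B_convex (t : R) (a1 a2 : 'I_n.+1 -> R) : 0 <= t <= 1 ->
    bfs_ball X M (step_fun L a1) -> bfs_ball X M (step_fun L a2) ->
    bfs_ball X M (step_fun L (fun i => t * a1 i + (1 - t) * a2 i)).
  move=> t01 B1 B2; apply: bfs_ball_ae (bfs_ball_convex t01 B1 B2).
  apply: nearW => x; rewrite [RHS]step_funE.
  transitivity (t * step_fun L a1 x + (1 - t) * step_fun L a2 x); first by [].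
  by rewrite !step_funE.
have B_symmetric (a1 a2 : 'I_n.+1 -> R) (sigma : 'I_n.+1 -> 'I_n.+1) :
    injective sigma -> (forall i, `|a2 i| = `|a1 (sigma i)|) ->
    bfs_ball X M (step_fun L a1) -> bfs_ball X M (step_fun L a2).
  move=> inj a12 [X1 M1].
  by have [X2 eqn] := hX X1 (equimeasurable_step_fun L inj a12); split; rewrite -?eqn.
apply: bfs_ball_ae (symmetric_convex_average B_convex B_symmetric hs b1 Ba).
apply: nearW => x; rewrite leibniz_opE !step_funE.
have -> : \int[P]_x (step_fun L b x * step_fun L a x) =
    n.+1%:R^-1 * \sum_i (b i * a i).
  rewrite -(Rintegral_step_fun L); apply: eq_Rintegral => y _.
  by rewrite !step_funE.
rewrite !Rintegral_step_fun.
set N : R := n.+1%:R.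
have N0 : N != 0 by rewrite pnatr_eq0.
transitivity (N^-1 * (2^-1 * (\sum_(j < n.+1) (b (L x) * a (L x)) +
   s * a (L x) * (\sum_j b j) + b (L x) * (\sum_j a j) - s * \sum_j (b j * a j)))).
  congr (_ * _); rewrite !mulr_sumr -!big_split/= -sumrB mulr_sumr.
  by apply: eq_bigr => j _; ring.
rewrite sumr_const card_ord -mulr_natr -/N.
by field.
Qed.

Lemma bfs_ball_leibniz_op (s : R) (phi u : {mfun T >-> R}) :
  s = 1 \/ s = -1 -> step_approximable phi u ->
  P.-integrable setT (EFin \o u) -> bfs_carrier X u ->
  bfs_ball X (bfs_norm X u) (leibniz_op s phi u).
Proof.
move=> hs [m [L [b [a [b1 approx]]]]] iu Xu.
have Bu : bfs_ball X (bfs_norm X u) u by [].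
apply: (@bfs_ball_fatou _ _ _ _ _ _
    (fun k => leibniz_op s (step_fun (L k) (b k)) (step_fun (L k) (a k)))).
  move=> k; apply: bfs_ball_leibniz_op_step => //.
  by apply: bfs_ball_ideal Bu _; apply: filterS approx => x [].
apply: cvg_leibniz_op => //.
- by move=> k x; rewrite step_funE.
- by apply: filterS approx => x [].
- by apply: filterS approx => x [].
- by apply: filterS approx => x [].
Qed.

End LeibnizOp.

(** * Subsets of prescribed probability in non-atomic spaces *)

Section Sierpinski.
Context d (T : measurableType d) (R : realType) (P : probability T R).
Implicit Types A B C S : set T.

Let p A : R := fine (P A).

Lemma prob_fine A : measurable A -> P A = (fine (P A))%:E.
Proof. by move=> mA; rewrite fineK// fin_num_measure. Qed.

Lemma fine_prob_ge0 A : 0 <= fine (P A).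
Proof. by rewrite fine_ge0. Qed.

Lemma fine_prob_le A B : measurable A -> measurable B -> A `<=` B ->
  fine (P A) <= fine (P B).
Proof.
by move=> mA mB AB; rewrite -lee_fin -!prob_fine// le_measure// inE.
Qed.

Lemma fine_prob_le1 A : measurable A -> fine (P A) <= 1.
Proof. by move=> mA; rewrite -lee_fin -prob_fine// probability_le1. Qed.

Lemma fine_probU A B : measurable A -> measurable B -> A `&` B = set0 ->
  fine (P (A `|` B)) = fine (P A) + fine (P B).
Proof.
move=> mA mB AB0; apply: EFin_inj.
by rewrite EFinD -!prob_fine//; [exact: measureU|exact: measurableU].
Qed.

Lemma fine_probD A B : measurable A -> measurable B -> B `<=` A ->
  fine (P (A `\` B)) = fine (P A) - fine (P B).
Proof.
move=> mA mB BA; have mD := measurableD mA mB.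
apply/eqP; rewrite -subr_eq opprK addrC -fine_probU//.
  by rewrite setDUK.
by apply/seteqP; split => // x [Bx [_ /(_ Bx)]].
Qed.

Hypothesis hP : nonatomic P.

Lemma nonatomic_halving A : measurable A -> 0 < p A ->
  exists B, [/\ measurable B, B `<=` A & 0 < p B <= p A / 2].
Proof.
move=> mA A0.
have [B [mB BA B0 AB0]] : exists B,
    [/\ measurable B, B `<=` A, 0 < p B & 0 < p (A `\` B)].
  apply: contrapT => noB; apply: (hP (A := A)); split => //.
    by rewrite [ltRHS]prob_fine// lte_fin.
  move=> B mB BA; apply: contrapT => /not_orP[B0 AB0]; apply: noB.
  have mAB := measurableD mA mB.
  exists B; split => //; rewrite lt_def fine_prob_ge0 andbT; apply/eqP => e0.
    by apply: B0; rewrite [LHS]prob_fine//; congr EFin.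
  by apply: AB0; rewrite [LHS]prob_fine//; congr EFin.
have e : p (A `\` B) = p A - p B by exact: fine_probD.
have [h|h] := leP (p B) (p A / 2); first by exists B; rewrite B0 h.
exists (A `\` B); split => //; [exact: measurableD|].
by apply/andP; split => //; lra.
Qed.

Lemma nonatomic_small_subset A (e : R) : measurable A -> 0 < p A -> 0 < e ->
  exists B, [/\ measurable B, B `<=` A & 0 < p B < e].
Proof.
move=> mA A0 e0.
have H n : exists B, [/\ measurable B, B `<=` A & 0 < p B <= (2^-1) ^+ n].
  elim: n => [|n [B [mB BA /andP[B0 Bn]]]].
    by exists A; split => //; rewrite A0 expr0 fine_prob_le1.
  have [C [mC CB /andP[C0 Cn]]] := nonatomic_halving mB B0.
  exists C; split => //; first exact: subset_trans BA.
  by rewrite C0 exprS; lra.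
have : (2^-1 : R) ^+ n @[n --> \oo] --> (0 : R).
  by apply: cvg_expr; rewrite ger0_norm ?invr_ge0// invf_lt1// ltr1n.
move=> /cvgrPdist_lt/(_ e e0)[N _ /(_ N (leqnn N))] /=.
rewrite sub0r normrN ger0_norm ?exprn_ge0 ?invr_ge0// => Ne.
have [B [mB BA /andP[B0 Bn]]] := H N.
by exists B; split => //; rewrite B0 (le_lt_trans Bn).
Qed.

(** The extension adds a piece at least half as large as the supremum of what
    fits below t, so that no other admissible piece is more than twice as
    large. *)
Lemma greedy_extension A S (t : R) : measurable A -> measurable S -> S `<=` A ->
  p S <= t ->
  exists S', [/\ measurable S', S `<=` S', S' `<=` A, p S' <= t &
    forall C, measurable C -> C `<=` A `\` S -> p S + p C <= t ->
      p C <= 2 * (p S' - p S)].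
Proof.
move=> mA mS SA St.
pose V := [set r | exists C,
  [/\ measurable C, C `<=` A `\` S, p S + p C <= t & p C = r]].
have supV : has_sup V.
  split; first by exists (p set0), set0; split => //; rewrite /p measure0 addr0.
  by exists 1 => _ [C [mC _ _ <-]]; exact: fine_prob_le1.
have [sV0|sV0] := leP (sup V) 0.
  exists S; split => // C mC CA Ct; rewrite subrr mulr0; apply: le_trans sV0.
  by apply: ub_le_sup; [case: supV|exists C].
have sV2 : 0 < sup V / 2 by rewrite divr_gt0.
have [_ [C [mC CA Ct <-]] ltC] := sup_adherent sV2 supV.
have SC0 : S `&` C = set0.
  by apply/seteqP; split => // x [Sx /CA[]].
have pSC : p (S `|` C) = p S + p C by exact: fine_probU.
exists (S `|` C); rewrite pSC; split => //.
- exact: measurableU.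
- by rewrite subUset; split => // x /CA[].
move=> D mD DA Dt.
have : p D <= sup V by apply: ub_le_sup; [case: supV|exists D].
by lra.
Qed.

(** Greedy extensions from the empty set have a union U of probability at most
    t. Were it smaller, a small subset C of the complement would have fitted at
    every stage, so every stage would have added at least half of the
    probability of C, which is impossible infinitely often. *)
Lemma nonatomic_subset_of_prob A (t : R) : measurable A -> 0 <= t <= p A ->
  exists B, [/\ measurable B, B `<=` A & p B = t].
Proof.
move=> mA /andP[t0 tA].
pose good S := [/\ measurable S, S `<=` A & p S <= t].
have ext (S : set T) : exists S', good S -> [/\ good S', S `<=` S' &
    forall C, measurable C -> C `<=` A `\` S -> p S + p C <= t ->
      p C <= 2 * (p S' - p S)].
  have [gS|] := pselect (good S); last by exists set0.
  case: gS => mS SA St; have [S' [mS' SS' S'A S't H]] := greedy_extension mA mS SA St.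
  by exists S' => _; split.
have {ext}[next nextP] := choice ext.
pose S n := iter n next set0.
have gS n : good (S n).
  elim: n => [|n /nextP[]//].
  by rewrite /S /=; split; [exact: measurable0|exact: sub0set|rewrite /p measure0].
have nextS n := nextP _ (gS n).
have ndS : nondecreasing_seq S.
  by apply/nondecreasing_seqP => n; apply/subsetPset; have [] := nextS n.
have mS n : measurable (S n) by have [] := gS n.
pose U := \bigcup_n S n.
have mU : measurable U by exact: bigcupT_measurable.
have UA : U `<=` A by move=> x [n _]; have [_ + _] := gS n; apply.
have Ut : p U <= t.
  rewrite -lee_fin /p -prob_fine//.
  have cvgU := nondecreasing_cvg_mu (mu := P) mS mU ndS.
  rewrite -(cvg_lim _ cvgU)//; apply: lime_le; first by apply/cvg_ex; exists (P U).
  by apply: nearW => n; rewrite /= [leLHS]prob_fine// lee_fin; have [] := gS n.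
exists U; split => //; apply/eqP; rewrite eq_le Ut leNgt; apply/negP => ltUt.
have AU0 : 0 < p (A `\` U) by rewrite /p fine_probD// subr_gt0 (lt_le_trans ltUt).
have dt : 0 < t - p U by rewrite subr_gt0.
have [C [mC CAU /andP[C0 Ct]]] := nonatomic_small_subset (measurableD mA mU) AU0 dt.
have SU n : p (S n) <= p U by apply: fine_prob_le => // x Sx; exists n.
have grow n : n%:R * (p C / 2) <= p (S n).
  elim: n => [|n IH]; first by rewrite mul0r fine_prob_ge0.
  have [_ _ H] := nextS n.
  have : p C <= 2 * (p (S n.+1) - p (S n)).
    apply: H => //.
      by move=> x /CAU[Ax Ux]; split => // Sx; apply: Ux; exists n.
    by apply: le_trans (lerD (SU n) (ltW Ct)) _; rewrite addrC subrK.
  rewrite mulrC -ler_pdivrMr// => h.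
  rewrite -[n.+1]addn1 natrD mulrDl mul1r.
  by rewrite -(subrKC (p (S n)) (p (S (n + 1)%N))) lerD// addn1.
have C2 : 0 < p C / 2 by rewrite divr_gt0.
have [n] : exists n, (p C / 2)^-1 < n%:R.
  by exists (Num.bound (p C / 2)^-1); rewrite archi_boundP// invr_ge0 ltW.
rewrite -(ltr_pM2r C2) mulVf ?gt_eqF// => h.
have := lt_le_trans h (le_trans (grow n) (fine_prob_le1 (mS n))).
by rewrite ltxx.
Qed.

End Sierpinski.

(** * Partitions into pieces of equal probability *)

Section Labellings.
Context d (T : measurableType d) (R : realType) (P : probability T R).

(** Label 0 marks the points that are not yet in a piece, and the piece of index
    i carries the label i + 1. Giving the newest piece the largest label keeps
    the earlier pieces unchanged and disjoint from it. *)
Definition partial_labelling (A : set T) (m : nat) (e : R)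
    (good : nat -> set T -> Prop) (l : T -> nat) :=
  [/\ forall x, (l x <= m)%N, forall x, (0 < l x)%N -> A x &
    forall i, (i < m)%N -> [/\ measurable (l @^-1` [set i.+1]),
      fine (P (l @^-1` [set i.+1])) = e & good i (l @^-1` [set i.+1])]].

Lemma partial_labelling0 A e good : partial_labelling A 0 e good (fun=> 0%N).
Proof. by []. Qed.

Lemma partial_labelling_extend (A B : set T) m e good l :
  measurable B -> B `<=` A -> fine (P B) = e -> good m B ->
  partial_labelling (A `\` B) m e good l ->
  exists l', partial_labelling A m.+1 e good l'.
Proof.
move=> mB BA PB gB [lm lA lP].
exists (fun x => if x \in B then m.+1 else l x); split => [x|x|i].
- by case: ifP => // _; exact: leqW.
- by case: ifPn => [/set_mem/BA//|_ /lA[]].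
rewrite ltnS leq_eqVlt => /predU1P[->|im].
  suff -> : (fun x => if x \in B then m.+1 else l x) @^-1` [set m.+1] = B by [].
  apply/seteqP; split => x /=; last by move=> Bx; rewrite mem_set.
  case: ifPn => [/set_mem//|_ lx]; by have := lm x; rewrite lx ltnn.
suff -> : (fun x => if x \in B then m.+1 else l x) @^-1` [set i.+1] =
          l @^-1` [set i.+1] by exact: lP.
apply/seteqP; split => x /=.
  by case: ifPn => // _ [im1]; rewrite im1 ltnn in im.
move=> lx; rewrite memNset// => Bx.
by have [|_] := lA x; [rewrite lx|apply].
Qed.

(** The unlabelled points form a null set, which is merged into the first
    piece. *)
Lemma equal_labelling_of_partial n good l :
  partial_labelling setT n.+1 n.+1%:R^-1 good l ->
  exists L : equal_labelling P n, forall x, L x = inord (l x).-1.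
Proof.
move=> [ln _ lP].
pose lab x : 'I_n.+1 := inord (l x).-1.
have lab_pos (i : 'I_n.+1) : i != ord0 -> lab @^-1` [set i] = l @^-1` [set i.+1].
  move=> i0; apply/seteqP; split => x /=.
    have lx1 : ((l x).-1 < n.+1)%N by case: (l x) (ln x).
    move=> labx; have := congr1 val labx; rewrite /lab /= inordK//.
    case: (l x) => [|j] /= ji; last by rewrite ji.
    by move: i0; rewrite -val_eqE /= -ji.
  by move=> lx; rewrite /lab lx /= inord_val.
have m_pos (i : 'I_n.+1) : i != ord0 -> measurable (lab @^-1` [set i]).
  by move=> i0; rewrite lab_pos//; have [] := lP i (ltn_ord i).
pose F (i : nat) := lab @^-1` [set inord i.+1].
have neq0 i : (i < n)%N -> (inord i.+1 : 'I_n.+1) != ord0.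
  by move=> ni; rewrite -val_eqE /= inordK.
have mF i : (i < n)%N -> measurable (F i) by move=> ni; apply/m_pos/neq0.
(* the first piece is obtained as the complement of the others *)
have lab0 : lab @^-1` [set ord0] = ~` \big[setU/set0]_(i < n) F i.
  rewrite -bigcup_mkord; apply/seteqP; split => x /=.
    by move=> labx [i /= ni]; rewrite /F /= labx => /esym/eqP; apply/negP/neq0.
  move=> nF; apply: contrapT => labx; apply: nF.
  have lab0 : (0 < lab x)%N.
    by rewrite lt0n; apply/eqP => e; apply: labx; exact: val_inj.
  exists (lab x).-1 => /=.
    by rewrite -ltnS prednK.
  by rewrite /F /= prednK ?inord_val.
have mU : measurable (\big[setU/set0]_(i < n) F i).
  by apply: bigsetU_measurable => i _; exact: mF.
have PF i : (i < n)%N -> P (F i) = (n.+1%:R^-1)%:E.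
  move=> ni; rewrite (prob_fine P (mF _ ni)) /F lab_pos ?neq0// inordK//.
  by have [|_ ->] := lP i.+1.
have PU : P (\big[setU/set0]_(i < n) F i) = (n%:R / n.+1%:R)%:E.
  rewrite measure_semi_additive_ord//=.
  - rewrite (eq_bigr (fun=> (n.+1%:R^-1)%:E)) => [|i _]; last exact: PF.
    by rewrite sumEFin sumr_const card_ord mulr_natl.
  - by move=> i; exact: mF.
  - apply/trivIsetP => i j _ _ ij; apply/seteqP; split => // x [] /=.
    rewrite /F/= => -> /(congr1 val) /=.
    rewrite !inordK ?ltnS ?ltn_ord// => -[/val_inj e].
    by rewrite e eqxx in ij.
have mlab i : measurable (lab @^-1` [set i]).
  have [->|] := eqVneq i ord0; last exact: m_pos.
  by rewrite lab0; exact: measurableC.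
have Plab i : P (lab @^-1` [set i]) = (n.+1%:R^-1)%:E.
  have [->|i0] := eqVneq i ord0.
    rewrite lab0 probability_setC// PU -EFinB; congr EFin.
    have n1 : n.+1%:R != 0 :> R by rewrite pnatr_eq0.
    by apply: (mulIf n1); rewrite mulrBl divfK// mulVf// mul1r -natrB// subSnn.
  rewrite (prob_fine P (mlab i)) lab_pos//.
  by have [_ ->] := lP i (ltn_ord i).
by exists (EqualLabelling mlab Plab).
Qed.

End Labellings.

(** * Partitions adapted to a finite cover *)

Section NonatomicApproximation.
Context d (T : measurableType d) (R : realType) (P : probability T R).

(** Rounding towards zero to a multiple of e, with the single value 0 once
    |u| exceeds the bound M. *)
Lemma finite_value_cover (u : {mfun T >-> R}) (e M : R) : 0 < e ->
  exists (I : finType) (C : I -> set T) (r : I -> R),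
    [/\ forall i, measurable (C i), forall x, exists i, C i x &
      forall i x, C i x ->
        `|r i| <= `|u x| /\ (`|u x| <= M -> `|u x - r i| <= e)].
Proof.
move=> e0; have [N MN] : exists N, M < N%:R * e.
  have [N h] : exists N, `|M| / e < N%:R.
    by exists (Num.bound (`|M| / e)); rewrite archi_boundP// divr_ge0// ltW.
  by exists N; rewrite -ltr_pdivrMr// (le_lt_trans _ h)// ler_pM2r ?invr_gt0// ler_norm.
pose sgu (b : bool) x : R := (-1) ^+ b * u x.
have sgu_norm b x : `|sgu b x| = `|u x| by rewrite normrMsign.
pose C (i : option (bool * 'I_N)) : set T :=
  if i is Some (b, j) then sgu b @^-1` `[j%:R * e, j.+1%:R * e[%classic
  else (fun x => `|u x|) @^-1` `[N%:R * e, +oo[%classic.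
pose r (i : option (bool * 'I_N)) : R :=
  if i is Some (b, j) then (-1) ^+ b * (j%:R * e) else 0.
exists (option (bool * 'I_N))%type, C, r; split => [[[b j]|]|x|[[b j]|] x].
- rewrite -[X in measurable X]setTI; have : measurable_fun setT (sgu b).
    exact: measurable_funM.
  by apply => //; exact: measurable_itv.
- rewrite -[X in measurable X]setTI; have : measurable_fun setT (fun x => `|u x|).
    exact: measurableT_comp.
  by apply => //; exact: measurable_itv.
- have [uN|Nu] := ltP `|u x| (N%:R * e); last first.
    by exists None; rewrite /C /= in_itv /= Nu.
  have ue0 : 0 <= `|u x| / e by rewrite divr_ge0// ltW.
  pose j := Num.truncn (`|u x| / e).
  have /andP[ju uj] : j%:R <= `|u x| / e < j.+1%:R by exact: truncn_itv.
  have jN : (j < N)%N.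
    by rewrite -(ltr_nat R) (le_lt_trans ju)// ltr_pdivrMr.
  exists (Some (u x < 0, Ordinal jN)); rewrite /C /= in_itv /= /sgu -normrEsign.
  by rewrite -ler_pdivlMr// ju -ltr_pdivrMr.
- rewrite /C /= in_itv /= => /andP[ju uj].
  have je0 : 0 <= j%:R * e by rewrite mulr_ge0// ltW.
  split; first by rewrite normrMsign ger0_norm// -(sgu_norm b) (le_trans ju)// ler_norm.
  move=> _; have -> : u x - (-1) ^+ b * (j%:R * e) = (-1) ^+ b * (sgu b x - j%:R * e).
    by rewrite mulrBr /sgu signrMK.
  rewrite normrMsign ger0_norm ?subr_ge0// lerBlDl (le_trans (ltW uj))//.
  by rewrite -[j.+1]addn1 natrD mulrDl mul1r.
- rewrite /C /= in_itv /= andbT normr0 => Nu; split => // uM.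
  by have := lt_le_trans MN (le_trans Nu uM); rewrite ltxx.
Qed.

Hypothesis hP : nonatomic P.

Lemma prob_le_sum_cover (I : finType) (C : I -> set T) A (c : R) :
  measurable A -> (forall i, measurable (C i)) -> (forall x, exists i, C i x) ->
  (forall i, fine (P (A `&` C i)) <= c) -> fine (P A) <= #|I|%:R * c.
Proof.
move=> mA mC cover Pc.
pose B (s : seq I) := [set x | A x /\ exists2 i, i \in s & C i x].
have [_ Bs] : measurable (B (enum I)) /\
    fine (P (B (enum I))) <= (size (enum I))%:R * c.
  elim: (enum I) => [|i s [mB PB]].
    have -> : B [::] = set0 by apply/seteqP; split => // x [_ []].
    by rewrite measure0 mul0r.
  have mACi : measurable (A `&` C i) by exact: measurableI.
  have mBD := measurableD mB mACi.
  have -> : B (i :: s) = (A `&` C i) `|` (B s `\` (A `&` C i)).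
    rewrite setUDr setDv setD0; apply/seteqP; split => x.
      move=> [Ax [j]]; rewrite inE => /predU1P[->|js] Cx; first by left.
      by right; split => //; exists j.
    case=> [[Ax Cx]|[Ax [j js Cx]]]; split => //.
      by exists i; rewrite ?mem_head.
    by exists j; rewrite ?inE ?js ?orbT.
  split; first exact: measurableU.
  rewrite fine_probU//; last by apply/seteqP; split => // x [ACx [_ /(_ ACx)]].
  rewrite /= -[(size s).+1]addn1 natrD mulrDl mul1r addrC lerD//.
  by apply: le_trans PB; apply: fine_prob_le => //; exact: subDsetl.
rewrite cardE (le_trans _ Bs)//.
suff -> : A = B (enum I) by [].
apply/seteqP; split => [x Ax|x []//]; split => //.
by have [i Cx] := cover x; exists i; rewrite ?mem_enum.
Qed.

(** Pieces are removed from the last index to the first. While more than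
    #|I| pieces remain, some member of the cover meets what is left in
    probability at least e, and the piece is taken inside it. Only the pieces
    of index less than #|I| may straddle several members. *)
Lemma nonatomic_partial_labelling (I : finType) (C : I -> set T) (e : R) m A :
  (forall i, measurable (C i)) -> (forall x, exists i, C i x) -> 0 < e ->
  measurable A -> fine (P A) = m%:R * e ->
  exists l, partial_labelling P A m e
    (fun i F => (#|I| <= i)%N -> exists j, F `<=` C j) l.
Proof.
move=> mC cover e0; elim: m A => [|m IH] A mA PA.
  by exists (fun=> 0%N); exact: partial_labelling0.
suff [B [mB BA PB gB]] : exists B, [/\ measurable B, B `<=` A, fine (P B) = e &
    (#|I| <= m)%N -> exists j, B `<=` C j].
  have [|l lP] := IH _ (measurableD mA mB).
    rewrite fine_probD// PA PB; apply/eqP; rewrite subr_eq.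
    by rewrite -[m.+1]addn1 natrD mulrDl mul1r.
  exact: partial_labelling_extend gB lP.
have [mI|Im] := ltnP m #|I|.
  have [|B [mB BA PB]] := nonatomic_subset_of_prob hP (t := e) mA.
    by rewrite (ltW e0)/= PA ler_peMl ?ler1n ?(ltW e0).
  by exists B; split => //; rewrite leqNgt mI.
have [[j jP]|noj] := pselect (exists j, e <= fine (P (A `&` C j))).
  have mACj := measurableI _ _ mA (mC j).
  have [|B [mB BA PB]] := nonatomic_subset_of_prob hP (t := e) mACj.
    by rewrite (ltW e0).
  exists B; split => //; first by move=> x /BA[].
  by move=> _; exists j => x /BA[].
have := prob_le_sum_cover (c := e) mA mC cover.
rewrite PA ler_pM2r// ler_nat leqNgt ltnS Im => h.
suff : false by [].
apply: h => i; rewrite leNgt; apply/negP => ei.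
by apply: noj; exists i; exact: ltW.
Qed.

End NonatomicApproximation.

(** * Approximation by step functions on non-atomic spaces *)

Section NonatomicStepApproximable.
Context d (T : measurableType d) (R : realType) (P : probability T R).
Hypothesis hP : nonatomic P.

(** Outside of the set D of straddling pieces, both functions are within 2^-k
    of their values on the piece. The number of pieces is chosen large compared
    with the size of the cover, which makes D small; on D the approximants
    vanish. *)
Lemma nonatomic_step_approximation (phi u : {mfun T >-> R}) (k : nat) :
  (forall x, `|phi x| <= 1) ->
  exists n (L : equal_labelling P n) (b a : 'I_n.+1 -> R) (D : set T),
    [/\ measurable D /\ (P D <= (2^-1 ^+ k)%:E)%E, forall i, `|b i| <= 1,
      forall x, `|step_fun L a x| <= `|u x|,
      forall x, ~ D x -> `|phi x - step_fun L b x| <= 2^-1 ^+ k &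
      forall x, ~ D x -> `|u x| <= k%:R -> `|u x - step_fun L a x| <= 2^-1 ^+ k].
Proof.
move=> phi1.
have e0 : 0 < 2^-1 ^+ k :> R by rewrite exprn_gt0// invr_gt0.
have [I1 [C1 [r1 [mC1 cover1 C1P]]]] := finite_value_cover phi 1 e0.
have [I2 [C2 [r2 [mC2 cover2 C2P]]]] := finite_value_cover u k%:R e0.
pose I : finType := (I1 * I2)%type.
pose C (i : I) := C1 i.1 `&` C2 i.2.
have mC i : measurable (C i) by exact: measurableI.
have cover x : exists i, C i x.
  by have [i Ci] := cover1 x; have [j Cj] := cover2 x; exists (i, j).
(* with (K + 1) * 2^k pieces, the K + 1 first ones have total probability 2^-k;
   counting K + 1 of them includes the first piece even if K = 0, as needed since
   that piece has absorbed the null set *)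
pose K := #|I|; pose n := (K.+1 * 2 ^ k).-1.
have nE : n.+1 = (K.+1 * 2 ^ k)%N by rewrite prednK// muln_gt0 expn_gt0.
have n0 : 0 < n.+1%:R :> R by [].
have [||l lP] := nonatomic_partial_labelling hP (e := n.+1%:R^-1) (m := n.+1)
    mC cover _ measurableT.
  by rewrite invr_gt0.
  by rewrite probability_setT mulfV// gt_eqF.
have [L LE] := equal_labelling_of_partial lP.
case: lP => ln _ lgood.
have fiber (i : 'I_n.+1) x : (0 < i)%N -> L x = i -> l x = i.+1.
  rewrite LE => i0 e; have := congr1 val e; rewrite /= inordK; last first.
    by case: (l x) (ln x).
  by case: (l x) => [|j] /= ji; [rewrite -ji in i0|rewrite ji].
have value i : exists v : R * R, [/\ `|v.1| <= 1,
    forall x, L x = i -> `|v.2| <= `|u x| &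
    forall x, L x = i -> (K < i)%N -> `|phi x - v.1| <= 2^-1 ^+ k /\
      (`|u x| <= k%:R -> `|u x - v.2| <= 2^-1 ^+ k)].
  have [iK|Ki] := leqP i K.
    by exists (0, 0); split => [|x _|x _] //=; rewrite normr0.
  have i0 : (0 < i)%N by exact: leq_ltn_trans Ki.
  have [_ _ /(_ (ltnW Ki))[j lj]] := lgood i (ltn_ord i).
  have Lj x : L x = i -> C j x by move=> Lx; apply: lj; exact: fiber.
  (* a piece has positive probability, so the bound 1 on phi at one of its points
     bounds the value chosen on it *)
  have [y Ly] : exists y, L y = i.
    apply: contrapT => noy; have := label_prob L i.
    rewrite (_ : L @^-1` [set i] = set0) ?measure0; last first.
      by apply/seteqP; split => // y Ly; apply: noy; exists y.
    by case => /esym/eqP; rewrite invr_eq0 pnatr_eq0.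
  exists (r1 j.1, r2 j.2).
  split => /= [|x /Lj[_ /C2P[]//]|x /Lj[/C1P[_ c1] /C2P[_ c2]] _].
    have [/C1P[r1y _] _] := Lj _ Ly; exact: le_trans (phi1 y).
  by split => //; exact: c1.
have [v vP] := choice value.
pose idx := step_fun L (fun i => (i : nat)%:R).
exists n, L, (fun i => (v i).1), (fun i => (v i).2), [set x | idx x <= K%:R].
have notD x : ~ (idx x <= K%:R) -> (K < L x)%N.
  by rewrite /idx step_funE ler_nat => /negP; rewrite -ltnNge.
split => [|i|x|x /= /notD Kx|x /= /notD Kx]; last first.
- by rewrite step_funE; have [_ _ /(_ x erefl Kx)[]] := vP (L x).
- by rewrite step_funE; have [_ _ /(_ x erefl Kx)[]] := vP (L x).
- by rewrite step_funE; have [_ + _] := vP (L x); apply.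
- by have [] := vP i.
split.
  rewrite (_ : [set x | _] = idx @^-1` `]-oo, K%:R]%classic).
    rewrite -[X in measurable X]setTI.
    by apply: measurable_funP => //; exact: measurable_itv.
  by apply/seteqP; split => x /=; rewrite in_itv.
rewrite (prob_step_fun L (fun y => y <= K%:R)) lee_fin.
have KN : (K.+1 <= n.+1)%N by rewrite nE leq_pmulr// expn_gt0.
rewrite (eq_bigr (fun i : 'I_n.+1 => if (i < K.+1)%N then 1 else 0)); last first.
  by move=> i _; rewrite ler_nat ltnS; case: leqP.
rewrite -big_mkcond -(big_ord_widen _ (fun=> 1) KN) sumr_const card_ord.
rewrite nE natrM invfM mulrAC mulVf ?pnatr_eq0// mul1r natrX exprVn.
exact: lexx.
Qed.

(** The exceptional sets have summable probabilities, so by the Borel-Cantelli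
    lemma almost every point is eventually outside of them. *)
Lemma nonatomic_step_approximable (phi u : {mfun T >-> R}) :
  (forall x, `|phi x| <= 1) -> step_approximable P phi u.
Proof.
move=> phi1.
have /choice[m] := fun k => nonatomic_step_approximation u k phi1.
move=> /(_ _)/cid-/all_sig[L]/(_ _)/cid-/all_sig[b]/(_ _)/cid-/all_sig[a].
move=> /(_ _)/cid-/all_sig[D] /all_and5[DP b1 au bphi aU].
exists m, L, b, a; split => //.
have mD k : measurable (D k) by have [] := DP k.
have D0 : (P : {measure set T -> \bar R}) (lim_sup_set D) = 0%E.
  apply: lim_sup_set_cvg0 => //.
  apply: (@le_lt_trans _ _ (\sum_(k <oo) (2^-1 ^+ k : R)%:E)%E).
    by apply: lee_nneseries => // k _; have [] := DP k.
  rewrite (eq_eseriesr (g := fun k => (2 / (2 ^ k.+1)%:R)%:E)) => [|k _].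
    by apply: le_lt_trans (epsilon_trick0 xpredT _) (ltry _).
  by rewrite expnS natrM invfM mulrA mulfV// mul1r natrX exprVn.
exists (lim_sup_set D); split => //.
  apply: bigcapT_measurable => n; exact: bigcup_measurable.
move=> x; apply: contra_notP => notD.
have [N DN] : exists N, forall k, (N <= k)%N -> ~ D k x.
  move: notD => /existsNP[N /not_implyP[_ notD]]; exists N => k Nk Dkx.
  by apply: notD; exists k.
have cvg2 : (2^-1 : R) ^+ k @[k --> \oo] --> (0 : R).
  by apply: cvg_expr; rewrite ger0_norm ?invr_ge0// invf_lt1// ltr1n.
split=> [k||]; first exact: au.
  apply/cvgrPdist_le => e e0.
  have /cvgrPdist_le/(_ e e0)[N' _ N'P] := cvg2.
  exists (maxn N N') => // k /=; rewrite geq_max => /andP[Nk N'k].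
  apply: le_trans (bphi k x (DN _ Nk)) _.
  by have := N'P _ N'k; rewrite sub0r normrN ger0_norm// exprn_ge0// invr_ge0.
apply/cvgrPdist_le => e e0.
have /cvgrPdist_le/(_ e e0)[N' _ N'P] := cvg2.
exists (maxn (maxn N N') (Num.bound `|u x|)) => // k /=.
rewrite !geq_max => /andP[/andP[Nk N'k] uk].
have ux : `|u x| <= k%:R.
  by rewrite ltW// (lt_le_trans (archi_boundP (normr_ge0 _)))// ler_nat.
apply: le_trans (aU k x (DN _ Nk) ux) _.
by have := N'P _ N'k; rewrite sub0r normrN ger0_norm// exprn_ge0// invr_ge0.
Qed.

End NonatomicStepApproximable.

(** * Approximation by step functions on atomic spaces *)

Section AtomicApproximation.
Context d (T : measurableType d) (R : realType) (P : probability T R).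

Lemma ae_meets (A : set T) (Q : T -> Prop) : measurable A -> (0 < P A)%E ->
  (\forall x \ae P, Q x) -> exists x, A x /\ Q x.
Proof.
move=> mA A0 [N [mN N0 NQ]]; apply: contrapT => noAQ.
suff : (P A <= P N)%E by rewrite [leRHS]N0 leNgt A0.
rewrite le_measure ?inE// => x Ax; apply: NQ => Qx.
by apply: noAQ; exists x.
Qed.

Lemma null_ae (N : set T) : measurable N -> P N = 0%E -> \forall x \ae P, ~ N x.
Proof. by move=> mN N0; exists N; split => // x /contrapT. Qed.

(** Each rational cut of u splits the atom into a null set and a set of full
    measure. Almost all points of the atom thus lie on the same side of all
    rational cuts, and two reals with the same rational cuts are equal. *)
Lemma atom_ae_constant (A : set T) (u : {mfun T >-> R}) : atom P A ->
  exists c, \forall x \ae P, A x -> u x = c.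
Proof.
move=> [mA A0 atomA].
pose low (q : rat) := A `&` u @^-1` `]-oo, ratr q]%classic.
have mlow q : measurable (low q).
  apply: measurableI => //; rewrite -[X in measurable X]setTI.
  by apply: measurable_funP => //; exact: measurable_itv.
have cut q : exists s : bool, \forall x \ae P, A x -> (u x <= ratr q) = s.
  have [low0|high0] := atomA (low q) (mlow q) (@subIsetl _ _ _).
    exists false; apply: filterS (null_ae (mlow q) low0) => x nlow Ax.
    by apply/negP => uq; apply: nlow; split => //=; rewrite in_itv.
  exists true; apply: filterS (null_ae (measurableD mA (mlow q)) high0) => x nhigh Ax.
  apply/negPn/negP => uq; apply: nhigh; split => // -[_] /=; rewrite in_itv /=.
  exact/negP.
have [s sP] := choice cut.
have cuts : \forall x \ae P, forall q, A x -> (u x <= ratr q) = s q.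
  (* a countable intersection, the rationals being enumerated by [unpickle] *)
  have : \forall x \ae P, forall n, if (unpickle n : option rat) is Some q then
      A x -> (u x <= ratr q) = s q else True.
    apply: ae_foralln => n; case: (unpickle n) => [q|]; first exact: sP.
    exact: nearW.
  by apply: filterS => x H q; have := H (pickle q); rewrite pickleK.
have [x0 [Ax0 cut0]] := ae_meets mA A0 cuts.
exists (u x0); apply: filterS cuts => x cutx Ax.
have [ux|ux|//] := ltgtP (u x) (u x0).
- have [q] := rat_in_itvoo ux; rewrite in_itv /= => /andP[xq qx0].
  have := cutx q Ax; rewrite -(cut0 q Ax0) (ltW xq) => /esym.
  by rewrite leNgt qx0.
- have [q] := rat_in_itvoo ux; rewrite in_itv /= => /andP[x0q qx].
  have := cutx q Ax; rewrite -(cut0 q Ax0) (ltW x0q).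
  by rewrite leNgt qx.
Qed.

Hypothesis hat : completely_atomic P.
Hypothesis heq : atoms_equal_measure P.

(** Atoms are removed one at a time; each one takes the same probability, so
    the process stops. *)
Lemma atomic_partial_labelling (A0 : set T) k A : atom P A0 -> measurable A ->
  fine (P A) < k%:R * fine (P A0) ->
  exists m l, partial_labelling P A m (fine (P A0)) (fun _ F => atom P F) l /\
    fine (P A) = m%:R * fine (P A0).
Proof.
move=> atomA0; elim: k A => [|k IH] A mA Ak.
  by move: Ak; rewrite mul0r ltNge fine_prob_ge0.
have [PA0|PA] := eqVneq (fine (P A)) 0.
  by exists 0%N, (fun=> 0%N); rewrite mul0r PA0; split => //; exact: partial_labelling0.
have [|B atomB BA] := hat mA.
  by rewrite [ltRHS]prob_fine// lte_fin lt_def PA fine_prob_ge0.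
have PB : fine (P B) = fine (P A0) by congr fine; exact: heq.
have mB : measurable B by case: atomB.
have [|m [l [lP Am]]] := IH _ (measurableD mA mB).
  by rewrite fine_probD// PB ltrBlDr -[X in _ < _ + X]mul1r -mulrDl natr1.
have [l' l'P] := partial_labelling_extend mB BA PB atomB lP.
exists m.+1, l'; split => //.
by rewrite -natr1 mulrDl mul1r -Am fine_probD// PB subrK.
Qed.

Lemma atomic_labelling : exists n (L : equal_labelling P n),
  forall (u : {mfun T >-> R}) i, exists c, \forall x \ae P, L x = i -> u x = c.
Proof.
have T0 : (0 < P setT)%E by rewrite probability_setT.
have [A0 atomA0 _] := hat measurableT T0.
have PA0 : 0 < fine (P A0).
  by case: atomA0 => mA0 + _; rewrite [ltRHS]prob_fine// lte_fin.
have [k] : exists k, (fine (P A0))^-1 < k%:R.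
  by exists (Num.bound (fine (P A0))^-1); rewrite archi_boundP// invr_ge0 ltW.
rewrite -(ltr_pM2r PA0) mulVf ?gt_eqF// => hk.
have PT : fine (P setT) = 1 by rewrite probability_setT.
have [|m [l [lP]]] := @atomic_partial_labelling A0 k setT atomA0 measurableT.
  by rewrite PT.
rewrite PT; case: m lP => [|n] lP Tn.
  by move/eqP: Tn; rewrite mul0r oner_eq0.
have en : fine (P A0) = n.+1%:R^-1.
  have n1 : n.+1%:R != 0 :> R by rewrite pnatr_eq0.
  by apply: (mulfI n1); rewrite -Tn mulfV.
rewrite en in lP.
have [L LE] := equal_labelling_of_partial lP.
exists n, L => u i; have [_ _ /(_ i (ltn_ord i))[mF PF atomF]] := lP.
have [c cP] := atom_ae_constant u atomF.
exists c; have FL : l @^-1` [set i.+1] `<=` L @^-1` [set i].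
  by move=> x /= lx; rewrite LE lx /= inord_val.
have mD := measurableD (label_measurable L i) mF.
(* the piece of L differs from the atom by a null set *)
have D0 : P ((L @^-1` [set i]) `\` (l @^-1` [set i.+1])) = 0%E.
  rewrite [LHS]prob_fine// fine_probD//; last exact: label_measurable.
  by rewrite PF label_prob subrr.
apply: filterS2 cP (null_ae mD D0) => x cx nD Lx; apply: cx.
by apply: contrapT => nlx; apply: nD; split.
Qed.

Lemma atomic_step_approximable (phi u : {mfun T >-> R}) :
  (forall x, `|phi x| <= 1) -> step_approximable P phi u.
Proof.
move=> phi1; have [n [L constL]] := atomic_labelling.
have [b bP] := choice (constL phi).
have [a aP] := choice (constL u).
have step_ae (v : {mfun T >-> R}) c :
    (forall i, \forall x \ae P, L x = i -> v x = c i) ->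
    \forall x \ae P, v x = step_fun L c x.
  move=> /filter_forall.
  by apply: filterS => x H; rewrite step_funE; exact: H.
exists (fun=> n), (fun=> L), (fun=> b), (fun=> a); split => [_ i|].
  have [|x [Lx bx]] := ae_meets (label_measurable L i) _ (bP i).
    by rewrite label_prob lte_fin invr_gt0.
  by rewrite -bx.
apply: filterS2 (step_ae _ _ bP) (step_ae _ _ aP) => x -> ->.
by split => //; exact: cvg_cst.
Qed.

End AtomicApproximation.

(** * Integral identities *)

Section IntegralLinearity.
Context d (T : measurableType d) (R : realType) (P : probability T R).

Definition integrable_mfun (h : {mfun T >-> R}) := P.-integrable setT (EFin \o h).

Lemma integrable_mfun_cst c : integrable_mfun (cst c).
Proof. exact: finite_measure_integrable_cst. Qed.

Lemma Rintegral_prob_cst c : \int[P]_x (cst c x) = c.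
Proof. by rewrite Rintegral_cst// [X in fine X]probability_setT mulr1. Qed.

Lemma integrable_mfun_le (f g : {mfun T >-> R}) :
  (forall x, `|f x| <= `|g x|) -> integrable_mfun g -> integrable_mfun f.
Proof.
move=> fg; apply: le_integrable => //; first exact/measurable_EFinP.
by move=> x _ /=; rewrite lee_fin.
Qed.

Lemma integrable_mfun_mul1 (phi u : {mfun T >-> R}) : (forall x, `|phi x| <= 1) ->
  integrable_mfun u -> integrable_mfun (phi * u).
Proof.
by move=> phi1; apply: integrable_mfun_le => x; rewrite /= normrM ler_piMl.
Qed.

(** Reduces identities between integrals to pointwise linear identities. *)
Lemma Rintegral_lincomb (s : seq (R * {mfun T >-> R})) :
  foldr (fun p Q => integrable_mfun p.2 /\ Q) True s ->
  integrable_mfun (\sum_(p <- s) p.1 *: p.2) /\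
  \int[P]_x (\sum_(p <- s) p.1 *: p.2) x = \sum_(p <- s) p.1 * \int[P]_x p.2 x.
Proof.
elim: s => [_|[a h] s IH /= [ih /IH[is_ Is]]].
  by rewrite !big_nil; split; [exact: integrable_mfun_cst|exact: Rintegral_prob_cst].
have iah : integrable_mfun (a *: h) by exact: (integrableZl (measurableT) a ih).
rewrite !big_cons; split; first exact: (integrableD measurableT iah is_).
by rewrite -Is -RintegralZl// -RintegralD.
Qed.

Lemma mean_centeredE (g : {mfun T >-> R}) x :
  mean_centered P g x = g x - \int[P]_x g x.
Proof. by []. Qed.

Lemma Rintegral_centered (f g : {mfun T >-> R}) :
  integrable_mfun f -> integrable_mfun (f * g) ->
  \int[P]_x (f x * mean_centered P g x) =
    \int[P]_x (f x * g x) - (\int[P]_x g x) * \int[P]_x f x.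
Proof.
move=> i_f ifg.
have [_ e] := @Rintegral_lincomb [:: (1, f * g); (- \int[P]_x g x, f)]
  (conj ifg (conj i_f I)).
rewrite !big_cons !big_nil !addr0/= mul1r mulNr in e.
rewrite -e; apply: eq_Rintegral => x _.
transitivity (1 * (f x * g x) + (- \int[P]_x g x) * f x); last by [].
by rewrite mean_centeredE; ring.
Qed.

Lemma Rintegral_mean_centered (g : {mfun T >-> R}) : integrable_mfun g ->
  \int[P]_x mean_centered P g x = 0.
Proof.
move=> ig; have := Rintegral_centered (integrable_mfun_cst 1) (g := g).
have -> : (cst 1 : {mfun T >-> R}) * g = g by apply/mfuneqP => x /=; rewrite mul1r.
move=> /(_ ig); rewrite Rintegral_prob_cst mulr1.
under eq_Rintegral do rewrite mul1r; move=> ->.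
by under eq_Rintegral do rewrite mul1r; rewrite subrr.
Qed.

Lemma mean_centered_mul (f g : {mfun T >-> R}) x :
  integrable_mfun f -> integrable_mfun g -> integrable_mfun (f * g) ->
  mean_centered P (f * g) x = leibniz_op P 1 f (mean_centered P g) x +
                              leibniz_op P 1 g (mean_centered P f) x.
Proof.
move=> i_f ig ifg; have igf : integrable_mfun (g * f) by rewrite mulrC.
rewrite !leibniz_opE !Rintegral_mean_centered// !Rintegral_centered//.
have -> : \int[P]_x (g x * f x) = \int[P]_x (f x * g x).
  by apply: eq_Rintegral => y _; rewrite mulrC.
rewrite !mean_centeredE.
have -> : (f * g) x = f x * g x by [].
have -> : \int[P]_x (f * g) x = \int[P]_x (f x * g x) by [].
by field.
Qed.

(** The transposition identity: both sides are the same linear combination of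
    the integrals of the eight products of phi, f, g and 1 in the list
    below. *)
Lemma Rintegral_mul_mean_centered_mul (phi f g : {mfun T >-> R}) :
  (forall x, `|phi x| <= 1) ->
  integrable_mfun f -> integrable_mfun g -> integrable_mfun (f * g) ->
  \int[P]_x (phi x * mean_centered P (f * g) x) =
  \int[P]_x (mean_centered P g x * leibniz_op P (-1) phi f x) +
  \int[P]_x (g x * leibniz_op P (-1) phi (mean_centered P f) x).
Proof.
move=> phi1 i_f ig ifg.
have i1 := integrable_mfun_cst 1.
have iphi : integrable_mfun phi.
  by apply: integrable_mfun_le i1 => x; rewrite /= normr1.
have iphif := integrable_mfun_mul1 phi1 i_f.
have iphig := integrable_mfun_mul1 phi1 ig.
have iphifg := integrable_mfun_mul1 phi1 ifg.
rewrite [LHS]Rintegral_centered//.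
have -> : \int[P]_x (phi x * (f * g) x) = \int[P]_x (phi * (f * g)) x by [].
have phif0 := Rintegral_centered iphi iphif.
have cf0 := Rintegral_mean_centered i_f.
(* named reals, so that the two integrands are compared as polynomials *)
have [F FE] : exists F, \int[P]_x f x = F by exists (\int[P]_x f x).
have [G GE] : exists G, \int[P]_x g x = G by exists (\int[P]_x g x).
have [H HE] : exists H, \int[P]_x phi x = H by exists (\int[P]_x phi x).
have [FH FHE] : exists FH, \int[P]_x (phi x * f x) = FH.
  by exists (\int[P]_x (phi x * f x)).
have [M1 M1E] : exists M1, \int[P]_x (phi * (f * g)) x = M1.
  by exists (\int[P]_x (phi * (f * g)) x).
have [M3 M3E] : exists M3, \int[P]_x (f * g) x = M3.
  by exists (\int[P]_x (f * g) x).
have [M5 M5E] : exists M5, \int[P]_x (phi * g) x = M5.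
  by exists (\int[P]_x (phi * g) x).
pose lin (a1 a2 a3 a4 a5 a6 a7 a8 : R) : seq (R * {mfun T >-> R}) :=
  [:: (a1, phi * (f * g)); (a2, phi * f); (a3, f * g); (a4, f); (a5, phi * g);
      (a6, phi); (a7, g); (a8, (cst 1 : {mfun T >-> R}))].
have linP a1 a2 a3 a4 a5 a6 a7 a8 (h : T -> R) :
   (forall x, h x = a1 * (phi x * (f x * g x)) + (a2 * (phi x * f x) +
     (a3 * (f x * g x) + (a4 * f x + (a5 * (phi x * g x) +
     (a6 * phi x + (a7 * g x + a8 * 1))))))) ->
   \int[P]_x h x = a1 * M1 + (a2 * FH + (a3 * M3 + (a4 * F + (a5 * M5 +
     (a6 * H + (a7 * G + a8)))))).
  move=> hE; have [|_ e] := @Rintegral_lincomb (lin a1 a2 a3 a4 a5 a6 a7 a8).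
    by do !split.
  rewrite /lin !big_cons !big_nil !addr0/= [\int[P]_x 1]Rintegral_prob_cst mulr1
    M1E M3E M5E HE GE FE [\int[P]_x (phi x * f x)]FHE in e.
  by rewrite -e; apply: eq_Rintegral => x _; rewrite hE.
rewrite (linP (2^-1) (- (2^-1 * G)) (- (2^-1 * H)) (2^-1 * (G * H)) (2^-1 * F)
  (- (2^-1 * (G * F))) (2^-1 * FH) (- (2^-1 * (G * FH)))
  (fun x => mean_centered P g x * leibniz_op P (-1) phi f x)) => [|x]; last first.
  by rewrite mean_centeredE leibniz_opE FE GE HE FHE; field.
rewrite (linP (2^-1) 0 (- (2^-1 * H)) 0 (- (2^-1 * F)) 0 (2^-1 * (H * F + FH - F * H)) 0
  (fun x => g x * leibniz_op P (-1) phi (mean_centered P f) x)) => [|x]; last first.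
  by rewrite leibniz_opE cf0 phif0 mean_centeredE FE HE FHE; field.
rewrite M1E M3E HE.
by field.
Qed.

End IntegralLinearity.

(** * Integrability of the functions of the space *)

Lemma ae_eq_Rintegral d (T : measurableType d) (R : realType)
    (P : probability T R) (f g : {mfun T >-> R}) :
  (\forall x \ae P, f x = g x) -> \int[P]_x f x = \int[P]_x g x.
Proof.
move=> fg; congr fine; apply: ae_eq_integral => //; [exact/measurable_EFinP..|].
by apply: filterS fg => x -> _.
Qed.

Section BfsIntegrable.
Context d (T : measurableType d) (R : realType) (P : probability T R).
Variable X : banach_function_space P.
Hypothesis hX : rearrangement_invariant X.
Hypothesis approx : forall phi u : {mfun T >-> R},
  (forall x, `|phi x| <= 1) -> step_approximable P phi u.

(** For phi = 1 and s = -1 the operator is the mean. *)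
Lemma bfs_ball_mean (u : {mfun T >-> R}) : bfs_carrier X u ->
  integrable_mfun P u -> bfs_ball X (bfs_norm X u) (cst (\int[P]_x u x)).
Proof.
move=> Xu iu.
have c1 x : `|(cst 1 : {mfun T >-> R}) x| <= 1 by rewrite /= normr1.
apply: bfs_ball_ae (bfs_ball_leibniz_op hX (or_intror erefl) (approx u c1) iu Xu).
apply: nearW => x; rewrite leibniz_opE Rintegral_prob_cst.
have -> : \int[P]_x ((cst 1 : {mfun T >-> R}) x * u x) = \int[P]_x u x.
  by apply: eq_Rintegral => y _; rewrite mul1r.
by rewrite /=; field.
Qed.

Definition truncation (u : {mfun T >-> R}) (k : nat) : {mfun T >-> R} :=
  min_mfun (mfun_Sub (mem_set
    (measurableT_comp (@normr_measurable R setT) (measurable_funP u)))) (cst k%:R).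

Lemma truncationE u k x : truncation u k x = Num.min `|u x| k%:R.
Proof. by []. Qed.

Lemma truncation_ge0 u k x : 0 <= truncation u k x.
Proof. by rewrite truncationE le_min normr_ge0 ler0n. Qed.

Lemma integrable_truncation u k : integrable_mfun P (truncation u k).
Proof.
apply: integrable_mfun_le (integrable_mfun_cst P k%:R) => x.
by rewrite ger0_norm ?truncation_ge0// [leRHS]ger0_norm// truncationE ge_min lexx orbT.
Qed.

Lemma bfs_ball_truncation u k : bfs_carrier X u ->
  bfs_ball X (bfs_norm X u) (truncation u k).
Proof.
move=> Xu; apply: (@bfs_ball_ideal _ _ _ _ _ _ _ u) => //; apply: nearW => x.
by rewrite ger0_norm ?truncation_ge0// truncationE ge_min lexx.
Qed.

Lemma bfs_ball_truncation_mean u k : bfs_carrier X u ->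
  bfs_ball X (bfs_norm X u) (cst (\int[P]_x truncation u k x)).
Proof.
move=> Xu; have [Xk uk] := bfs_ball_truncation k Xu.
have [Xm mk] := bfs_ball_mean Xk (integrable_truncation u k).
by split => //; exact: le_trans uk.
Qed.

(** If u is not null, its truncation at 1 is bounded and has a positive
    mean, which is a constant function in X. *)
Lemma bfs_carrier_cst u c : bfs_carrier X u ->
  ~ (\forall x \ae P, u x = 0) -> bfs_carrier X (cst c).
Proof.
move=> Xu u0.
have [m0|m0] := eqVneq (\int[P]_x truncation u 1 x) 0.
  exfalso; apply: u0.
  have it := integrable_truncation u 1.
  have : (\int[P]_x `|(truncation u 1 x)%:E| = 0)%E.
    under eq_integral do rewrite /= ger0_norm ?truncation_ge0//.
    by rewrite -[LHS]fineK ?integrable_fin_num//; congr EFin.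
  move/ae_eq_integral_abs => /(_ measurableT).
  have mt : measurable_fun setT (EFin \o truncation u 1) by apply/measurable_EFinP.
  move=> /(_ mt); apply: filterS => x /(_ I)/= [].
  by rewrite minElt; case: ifP => [_ /eqP|_ /eqP];
    rewrite ?normr_eq0 ?oner_eq0// => /eqP.
have [Xm _] := bfs_ball_truncation_mean 1 Xu.
pose m := \int[P]_x truncation u 1 x.
pose v : {mfun T >-> R} := (c / m) *: (cst m : {mfun T >-> R}).
have [] // := @bfs_ball_ae _ _ _ _ X (bfs_norm X v) (cst c) v.
  by apply: nearW => x; rewrite mfunZE /= divfK.
by split => //; exact: bfs_Z.
Qed.

(** The constants given by the means of the truncations of |u| have norm at
    most the norm of u. As the constant 1 has positive norm, the means are
    bounded, and monotone convergence applies. *)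
Lemma bfs_integrable (u : {mfun T >-> R}) : bfs_carrier X u -> integrable_mfun P u.
Proof.
move=> Xu; have mu_ : measurable_fun setT (EFin \o u) by apply/measurable_EFinP.
apply/integrableP; split => //.
have [u0|u0] := pselect (\forall x \ae P, u x = 0).
  suff -> : (\int[P]_x `|(EFin \o u) x| = 0)%E by rewrite ltry.
  by apply/ae_eq_integral_abs => //; apply: filterS u0 => x /= ->.
have X1 := bfs_carrier_cst 1 Xu u0.
have N1 : 0 < bfs_norm X (cst 1).
  rewrite lt_def bfs_norm_ge0// andbT; apply/eqP => /(bfs_norm_eq0 X1) ae0.
  have [|x [_ /eqP]] := ae_meets measurableT _ ae0; first by rewrite probability_setT.
  by rewrite /= oner_eq0.
pose M := bfs_norm X u / bfs_norm X (cst 1).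
have le_M k : \int[P]_x truncation u k x <= M.
  have [_ +] := bfs_ball_truncation_mean k Xu.
  have -> : (cst (\int[P]_x truncation u k x) : {mfun T >-> R}) =
      (\int[P]_x truncation u k x) *: (cst 1 : {mfun T >-> R}).
    by apply/mfuneqP => x; rewrite mfunZE /= mulr1.
  rewrite bfs_normZ// ler_pdivlMr// => /(le_trans _); apply.
  by rewrite ler_wpM2r ?(ltW N1)// ler_norm.
have cvg_trunc x : ((truncation u k x)%:E @[k --> \oo] --> `|(EFin \o u) x|)%E.
  apply: cvg_EFin; first exact: nearW.
  apply: cvg_near_cst; near=> k.
  transitivity (Num.min `|u x| k%:R); [by []|apply/min_idPl].
  rewrite ltW// (lt_le_trans (archi_boundP (normr_ge0 (u x))))// ler_nat.
  by near: k; exact: nbhs_infty_ge.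
have cvgI : (\int[P]_x (truncation u k x)%:E @[k --> \oo] -->
    \int[P]_x `|(EFin \o u) x|)%E.
  have limE : (fun x => `|(EFin \o u) x|)%E =
      (fun x => limn (fun k => (truncation u k x)%:E)).
    apply/funext => x; apply/esym/cvg_lim => //; exact: cvg_trunc.
  rewrite limE; apply: cvg_monotone_convergence => //.
  - by move=> k; apply/measurable_EFinP.
  - by move=> k x _; rewrite lee_fin truncation_ge0.
  - move=> x _ k1 k2 k12; rewrite lee_fin !truncationE le_min !ge_min lexx/=.
    by rewrite ler_nat k12 orbT.
apply: (@le_lt_trans _ _ M%:E); last exact: ltry.
rewrite -(cvg_lim _ cvgI)//; apply: lime_le.
  by apply/cvg_ex; eexists; exact: cvgI.
apply: nearW => k; rewrite -[leLHS]fineK.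
  by rewrite lee_fin; exact: le_M.
exact: integrable_fin_num (integrable_truncation u k).
Unshelve. all: by end_near. Qed.

Lemma bfs_carrier_mean_centered (u : {mfun T >-> R}) : bfs_carrier X u ->
  bfs_carrier X (mean_centered P u).
Proof.
move=> Xu; apply: bfs_D => //.
have [Xm _] := bfs_ball_mean Xu (bfs_integrable Xu).
have [] // : bfs_ball X (bfs_norm X (cst (\int[P]_x u x)))
    (- (cst (\int[P]_x u x) : {mfun T >-> R})).
apply: (@bfs_ball_ideal _ _ _ _ _ _ _ (cst (\int[P]_x u x))) => //.
by apply: nearW => x /=; rewrite normrN.
Qed.

Lemma bfs_ball_leibniz_op_scaled (s c : R) (phi u : {mfun T >-> R}) :
  s = 1 \/ s = -1 -> 0 <= c -> (\forall x \ae P, `|phi x| <= c) ->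
  bfs_carrier X u -> bfs_ball X (c * bfs_norm X u) (leibniz_op P s phi u).
Proof.
move=> hs c0 phic Xu.
pose psi : {mfun T >-> R} := max_mfun (cst (-1)) (min_mfun (cst 1) (c^-1 *: phi)).
have psi1 x : `|psi x| <= 1.
  rewrite ler_norml /psi /= le_max lexx/= ge_max ge_min lexx/= andbT.
  by rewrite (le_trans _ ler01)// lerN10.
have phiE : \forall x \ae P, phi x = c * psi x.
  apply: filterS phic => x phix.
  (* for c = 0 the inverse is 0 and both sides vanish *)
  have [cz|cn0] := eqVneq c 0.
    by move: phix; rewrite cz mul0r normr_le0 => /eqP.
  have cp : 0 < c by rewrite lt_def cn0.
  have : -1 <= c^-1 * phi x <= 1.
    rewrite -ler_norml normrM gtr0_norm ?invr_gt0// mulrC ler_pdivrMr// mul1r.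
    exact: phix.
  move=> /andP[l1 l2]; have -> : psi x = c^-1 * phi x.
    rewrite /psi /= (_ : Num.min 1 (c^-1 * phi x) = c^-1 * phi x); last exact/min_idPr.
    exact/max_idPr.
  by rewrite mulrA mulfV// mul1r.
have [Xl lu] := bfs_ball_leibniz_op hX hs (approx u psi1) (bfs_integrable Xu) Xu.
have Bl : bfs_ball X (c * bfs_norm X u) (c *: leibniz_op P s psi u).
  by split; [exact: bfs_Z|rewrite bfs_normZ// ger0_norm// ler_wpM2l].
apply: bfs_ball_ae Bl.
have i1 : integrable_mfun P psi.
  by apply: integrable_mfun_le (integrable_mfun_cst P 1) => x; rewrite [leRHS]normr1.
have ipu := integrable_mfun_mul1 psi1 (bfs_integrable Xu).
have e1 : \int[P]_x phi x = c * \int[P]_x psi x.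
  rewrite -(RintegralZl c measurableT i1).
  exact: (ae_eq_Rintegral (g := c *: psi)).
have e2 : \int[P]_x (phi x * u x) = c * \int[P]_x (psi x * u x).
  rewrite -(RintegralZl c measurableT ipu).
  apply: (ae_eq_Rintegral (f := phi * u) (g := c *: (psi * u))).
  apply: filterS phiE => x phix; rewrite mfunZE.
  by transitivity (phi x * u x); [by []|rewrite phix -mulrA].
apply: filterS phiE => x phix.
by rewrite mfunZE !leibniz_opE e1 e2 phix; ring.
Qed.

End BfsIntegrable.

(** * The two Leibniz inequalities *)

Section Associate.
Context d (T : measurableType d) (R : realType) (P : probability T R).
Variable X : banach_function_space P.

Lemma associate_norm_ge0 (g : {mfun T >-> R}) : (0 <= associate_norm X g)%E.
Proof.
apply: ereal_sup_ubound; exists 0; first split.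
- exact: bfs_0.
- have [_ ->] := bfs_norm_eq0 (bfs_0 X); first exact: ler01.
  exact: nearW.
- by under eq_integral do rewrite /= mulr0; rewrite integral0.
Qed.

(** Testing g against |h| times the sign of g, divided by the norm of h. *)
Lemma integral_abs_mul_le_associate (g h : {mfun T >-> R}) : bfs_carrier X h ->
  (\int[P]_x `|g x * h x|%:E <= (bfs_norm X h)%:E * associate_norm X g)%E.
Proof.
move=> Xh.
have mgh : measurable_fun setT (fun x => `|g x * h x|%:E).
  by apply/measurable_EFinP; apply: measurableT_comp => //; exact: measurable_funM.
have [h0|h0] := eqVneq (bfs_norm X h) 0.
  rewrite h0 mul0e le_eqVlt; apply/orP; left; apply/eqP.
  rewrite (ae_eq_integral (cst 0)%E) ?integral0//.
  have /(bfs_norm_eq0 Xh) := h0; apply: filterS => x -> _ /=.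
  by rewrite mulr0 normr0.
have hp : 0 < bfs_norm X h by rewrite lt_def h0 bfs_norm_ge0.
have mk : measurable_fun setT (fun x => if g x < 0 then - `|h x| else `|h x|).
  apply: measurable_fun_ifT.
  - exact: measurable_fun_ltr.
  - by apply: measurableT_comp => //; exact: measurableT_comp.
  - exact: measurableT_comp.
pose k : {mfun T >-> R} := mfun_Sub (mem_set mk).
have gk x : g x * k x = `|g x * h x|.
  rewrite /= normrM; case: ltP => gx.
    by rewrite ltr0_norm// mulrN mulNr.
  by rewrite ger0_norm.
have Bk : bfs_ball X (bfs_norm X h) k.
  apply: (@bfs_ball_ideal _ _ _ _ _ _ _ h) => //; apply: nearW => x /=.
  by case: ifP; rewrite ?normrN normr_id.
have [Xk kh] := Bk.
have : ((bfs_norm X h)^-1%:E * \int[P]_x `|g x * h x|%:E <= associate_norm X g)%E.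
  apply: ereal_sup_ubound; exists ((bfs_norm X h)^-1 *: k); first split.
  - exact: bfs_Z.
  - by rewrite bfs_normZ// gtr0_norm ?invr_gt0// mulrC ler_pdivrMr// mul1r.
  - rewrite -ge0_integralZl//; last by rewrite lee_fin invr_ge0 ltW.
    apply: eq_integral => x _; rewrite -EFinM; congr EFin.
    by rewrite mfunZE mulrCA gk.
by rewrite muleC lee_pdivrMr// muleC.
Qed.

Lemma integrable_mul_associate (g h : {mfun T >-> R}) :
  bfs_carrier X h -> associate_space X g -> integrable_mfun P (g * h).
Proof.
move=> Xh Xg; apply/integrableP; split; first exact/measurable_EFinP.
apply: le_lt_trans (integral_abs_mul_le_associate g Xh) _.
have : associate_norm X g \is a fin_num.
  by rewrite ge0_fin_numE//; exact: associate_norm_ge0.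
by move=> /fineK <-; rewrite -EFinM ltry.
Qed.

End Associate.

Section LeibnizInequalities.
Context d (T : measurableType d) (R : realType) (P : probability T R).
Variable X : banach_function_space P.
Hypothesis hX : rearrangement_invariant X.
Hypothesis approx : forall phi u : {mfun T >-> R},
  (forall x, `|phi x| <= 1) -> step_approximable P phi u.

Lemma Lnorm_oo_ae (f : {mfun T >-> R}) : finite_norm P +oo%E f ->
  exists2 c, ('N[P]_+oo[EFin \o f] = c%:E)%E &
    0 <= c /\ \forall x \ae P, `|f x| <= c.
Proof.
rewrite /finite_norm => fin.
have fn : 'N[P]_+oo[EFin \o f]%E \is a fin_num by rewrite ge0_fin_numE ?Lnorm_ge0.
exists (fine 'N[P]_+oo[EFin \o f]%E); first by rewrite fineK.
split; first by rewrite fine_ge0// Lnorm_ge0.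
have : \forall x \ae P, (`|(EFin \o f) x| <= 'N[P]_+oo[EFin \o f])%E.
  have PT : (0 < (P : {measure set T -> \bar R}) setT)%E.
    by rewrite [ltRHS]probability_setT.
  rewrite unlock /Lnorm PT; exact: (ess_sup_ge P (abse \o (EFin \o f))).
by apply: filterS => x; rewrite -{1}(fineK fn) /= lee_fin.
Qed.

Lemma leibniz_bounded (f g : {mfun T >-> R}) :
  bfs_carrier X f -> bfs_carrier X g ->
  finite_norm P +oo%E f -> finite_norm P +oo%E g ->
  ((bfs_norm X (mean_centered P (f * g)%R))%:E <=
      'N[P]_+oo[EFin \o f] * (bfs_norm X (mean_centered P g))%:E +
      'N[P]_+oo[EFin \o g] * (bfs_norm X (mean_centered P f))%:E)%E.
Proof.
move=> Xf Xg /Lnorm_oo_ae[F -> [F0 fF]] /Lnorm_oo_ae[G -> [G0 gG]].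
have i_f := bfs_integrable hX approx Xf; have ig := bfs_integrable hX approx Xg.
have Xfg : bfs_carrier X (f * g).
  have [] // := bfs_ideal (f := f * g) (bfs_Z F Xg).
  by apply: filterS fF => x fx; rewrite mfunZE /= !normrM (ger0_norm F0) ler_wpM2r.
have ifg := bfs_integrable hX approx Xfg.
have s1 : (1 : R) = 1 \/ (1 : R) = -1 by left.
have Xf0 := bfs_carrier_mean_centered hX approx Xf.
have Xg0 := bfs_carrier_mean_centered hX approx Xg.
have [X1 N1] := bfs_ball_leibniz_op_scaled hX approx s1 F0 fF Xg0.
have [X2 N2] := bfs_ball_leibniz_op_scaled hX approx s1 G0 gG Xf0.
rewrite -!EFinM -EFinD lee_fin.
have -> : mean_centered P (f * g) = leibniz_op P 1 f (mean_centered P g) +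
                              leibniz_op P 1 g (mean_centered P f).
  by apply/mfuneqP => x; rewrite mean_centered_mul.
by apply: le_trans (bfs_normD X1 X2) _; exact: lerD.
Qed.

Lemma bfs_ae0_or_cst (u : {mfun T >-> R}) : bfs_carrier X u ->
  (\forall x \ae P, u x = 0) \/ bfs_carrier X (cst 1).
Proof.
move=> Xu; have [u0|u0] := pselect (\forall x \ae P, u x = 0); first by left.
by right; exact: (bfs_carrier_cst hX approx 1 Xu u0).
Qed.

Lemma Rintegral_le_integral_abs (h : {mfun T >-> R}) : integrable_mfun P h ->
  ((\int[P]_x h x)%:E <= \int[P]_x `|h x|%:E)%E.
Proof.
move=> ih; rewrite /Rintegral fineK ?integrable_fin_num//.
apply: le_trans (lee_abs _) _.
by apply: le_abse_integral => //; apply/measurable_EFinP.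
Qed.

Lemma leibniz_associate (f g : {mfun T >-> R}) :
  bfs_carrier X f -> associate_space X g ->
  ('N[P]_1[EFin \o mean_centered P (f * g)%R] <=
      (bfs_norm X f)%:E * associate_norm X (mean_centered P g) +
      associate_norm X g * (bfs_norm X (mean_centered P f))%:E)%E.
Proof.
move=> Xf Xg; have Xf0 := bfs_carrier_mean_centered hX approx Xf.
have rhs0 : (0 <= (bfs_norm X f)%:E * associate_norm X (mean_centered P g) +
      associate_norm X g * (bfs_norm X (mean_centered P f))%:E)%E.
  by rewrite adde_ge0// mule_ge0 ?associate_norm_ge0 ?lee_fin ?bfs_norm_ge0.
rewrite Lnorm1.
(* if X contains only null functions then g may fail to be integrable, but f is
   null; otherwise X contains the constants and g is integrable *)
have [f0|X1] := bfs_ae0_or_cst Xf.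
  suff -> : (\int[P]_x `|(EFin \o mean_centered P (f * g)%R) x| = 0)%E by [].
  apply/ae_eq_integral_abs => //; first exact/measurable_EFinP.
  have fg0 : \forall x \ae P, (f * g)%R x = (cst 0 : {mfun T >-> R}) x.
    apply: filterS f0 => x fx0; transitivity (f x * g x); first by [].
    by rewrite fx0 mul0r.
  have := ae_eq_Rintegral fg0; rewrite Rintegral_prob_cst => e.
  apply: filterS fg0 => x fgx _; congr EFin.
  by rewrite [LHS]mean_centeredE e fgx subr0.
have i_f := bfs_integrable hX approx Xf.
have ig : integrable_mfun P g.
  have := integrable_mul_associate X1 Xg; congr (integrable_mfun P _).
  by apply/mfuneqP => x /=; rewrite mulr1.
have ifg : integrable_mfun P (f * g).
  by rewrite mulrC; exact: (integrable_mul_associate Xf Xg).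
pose F := mean_centered P (f * g).
have iF : integrable_mfun P F.
  exact: (integrableB measurableT ifg (integrable_mfun_cst P (\int[P]_x (f * g)%R x))).
have mphi : measurable_fun setT (fun x => if F x < 0 then -1 else 1 : R).
  by apply: measurable_fun_ifT => //; exact: measurable_fun_ltr.
pose phi : {mfun T >-> R} := mfun_Sub (mem_set mphi).
have phiN x : `|phi x| = 1 by rewrite /phi /=; case: ifP; rewrite ?normrN normr1.
have phi1 x : `|phi x| <= 1 by rewrite phiN.
have phiF x : phi x * F x = `|F x|.
  rewrite /phi [X in X * _](_ : _ = if F x < 0 then -1 else 1)//.
  by case: ltP => Fx; [rewrite mulN1r ltr0_norm|rewrite mul1r ger0_norm].
have sm1 : (-1 : R) = 1 \/ (-1 : R) = -1 by right.
have [XU NU] := bfs_ball_leibniz_op hX sm1 (approx f phi1) i_f Xf.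
have if0 := bfs_integrable hX approx Xf0.
have [XV NV] := bfs_ball_leibniz_op hX sm1 (approx (mean_centered P f) phi1) if0 Xf0.
set U := leibniz_op P (-1) phi f in XU NU.
set V := leibniz_op P (-1) phi (mean_centered P f) in XV NV.
have iU := bfs_integrable hX approx XU.
have igU : integrable_mfun P (g * U) by exact: (integrable_mul_associate _ Xg).
have igV : integrable_mfun P (g * V) by exact: (integrable_mul_associate _ Xg).
have ig0U : integrable_mfun P (mean_centered P g * U).
  have [+ _] := @Rintegral_lincomb _ _ _ P [:: (1, g * U); (- \int[P]_x g x, U)]
    (conj igU (conj iU I)).
  congr (integrable_mfun P _); apply/mfuneqP => x.
  rewrite !big_cons big_nil addr0.
  transitivity (1 * (g x * U x) + (- \int[P]_x g x) * U x); first by [].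
  transitivity ((g x - \int[P]_x g x) * U x); last by [].
  by ring.
have -> : (\int[P]_x `|(EFin \o F) x| = (\int[P]_x (phi x * F x))%:E)%E.
  rewrite /Rintegral fineK; last first.
    exact: (integrable_fin_num measurableT (integrable_mfun_mul1 phi1 iF)).
  by apply: eq_integral => x _; rewrite phiF.
rewrite Rintegral_mul_mean_centered_mul// EFinD; apply: leeD.
  apply: le_trans (Rintegral_le_integral_abs ig0U) _.
  apply: le_trans (integral_abs_mul_le_associate (mean_centered P g) XU) _.
  by apply: lee_wpmul2r; [exact: associate_norm_ge0|rewrite lee_fin].
apply: le_trans (Rintegral_le_integral_abs igV) _.
apply: le_trans (integral_abs_mul_le_associate g XV) _.
rewrite muleC; apply: lee_wpmul2l; [exact: associate_norm_ge0|by rewrite lee_fin].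
Qed.

End LeibnizInequalities.

Unset Implicit Arguments.

Theorem theorem4p3 (d : measure_display) (T : measurableType d) (R : realType)
  (P : probability T R) (X : banach_function_space P)
  (hP : nonatomic P \/ (completely_atomic P /\ atoms_equal_measure P))
  (hX : rearrangement_invariant X) :
  (forall f g : {mfun T >-> R}, bfs_carrier X f -> bfs_carrier X g ->
     finite_norm P +oo%E f -> finite_norm P +oo%E g ->
     ((bfs_norm X (mean_centered P (f * g)%R))%:E <=
        'N[P]_+oo[EFin \o f] * (bfs_norm X (mean_centered P g))%:E +
        'N[P]_+oo[EFin \o g] * (bfs_norm X (mean_centered P f))%:E)%E) /\
  (forall f g : {mfun T >-> R}, bfs_carrier X f -> associate_space X g ->
     ('N[P]_1[EFin \o mean_centered P (f * g)%R] <=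
        (bfs_norm X f)%:E * associate_norm X (mean_centered P g) +
        associate_norm X g * (bfs_norm X (mean_centered P f))%:E)%E).
Proof.
have approx (phi u : {mfun T >-> R}) :
    (forall x, `|phi x| <= 1) -> step_approximable P phi u.
  case: hP => [nP|[aP eP]]; first exact: nonatomic_step_approximable.
  exact: atomic_step_approximable.
split=> [f g Xf Xg ff gg|f g Xf Xg].
  exact: leibniz_bounded.
exact: leibniz_associate.
Qed.
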